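(* Let $S_0$ be a positive compact operator on $L^2(\mathbb{R}^d)$, let $c\ge0$, and set $S=c\,\mathrm{Id}+S_0$. Let $1\le p<\infty$, and let $\Omega\subset\mathbb{R}^{2d}$ be measurable with $0<|\Omega|<\infty$. If $\|f_n\|_{L^2}=1$ for all $n$ and $f_n\rightharpoonup f$ weakly in $L^2(\mathbb{R}^d)$, then $$\|Q_Sf_n\|_{L^p(\Omega)}\longrightarrow\bigl\|Q_Sf+c(1-\|f\|_{L^2}^2)\bigr\|_{L^p(\Omega)}=\bigl\|c+Q_{S_0}f\bigr\|_{L^p(\Omega)}.$$ The supremum $$\Lambda_{p,\Omega}(S)=\sup_{f\in L^2(\mathbb{R}^d)\setminus\{0\}}\frac{\|Q_Sf\|_{L^p(\Omega)}}{\|f\|_{L^2}^2}$$ is therefore attained.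
   Context: $L^2(\mathbb{R}^d)$ is a complex Hilbert space with inner product linear in the first entry. For $z=(x,\xi)\in\mathbb{R}^{2d}$, $\pi(z)f(y)=e^{2\pi i\xi\cdot y}f(y-x)$; for a bounded operator $S$ on $L^2(\mathbb{R}^d)$, $\alpha_z(S)=\pi(z)S\pi(z)^*$ and $Q_Sf(z)=\langle\alpha_z(S)f,f\rangle$. ''Positive'' means $\langle S_0f,f\rangle\ge0$ for all $f$. *)

(* Defs.v *)
From HB Require Import structures.
From mathcomp Require Import all_boot all_order all_algebra.
From mathcomp Require Import complex ring.
From mathcomp Require Import all_classical all_reals all_analysis.
From mathcomp Require Import measurable_realfun.
Set Implicit Arguments.
Unset Strict Implicit.
Unset Printing Implicit Defensive.
Import Order.TTheory GRing.Theory Num.Theory.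
Import numFieldNormedType.Exports.
Local Open Scope classical_set_scope.
Local Open Scope ring_scope.

Definition tcons (T : Type) d (p : T * d.-tuple T) : d.+1.-tuple T :=
  [tuple of p.1 :: p.2].

(* The library proves this but its canonical instance is shadowed by the one for
   subprobability measures. *)
Lemma product_measure_sigma_finite d1 d2 (T1 : measurableType d1)
    (T2 : measurableType d2) (R : realType)
    (m1 : {sigma_finite_measure set T1 -> \bar R})
    (m2 : {sigma_finite_measure set T2 -> \bar R}) :
  sigma_finite setT (m1 \x m2)%E.
Proof.
have /sigma_finiteP[F [TF ndF Foo]] := sigma_finiteT m1.
have /sigma_finiteP[G [TG ndG Goo]] := sigma_finiteT m2.
exists (fun n => F n `*` G n).
  rewrite -setXTT TF TG predeqE => -[x y]; split.
    move=> [/= [n _ Fnx] [k _ Gky]]; exists (maxn n k) => //; split.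
    - by move: x Fnx; exact/subsetPset/ndF/leq_maxl.
    - by move: y Gky; exact/subsetPset/ndG/leq_maxr.
  by move=> [n _ []/= ? ?]; split; exists n.
move=> k; have [? ?] := Foo k; have [? ?] := Goo k.
split; first exact: measurableX.
by rewrite product_measure1E// lte_mul_pinfty// ge0_fin_numE.
Qed.

Section lebesgue_tuple.
Context (R : realType).

Lemma measurable_tcons d :
  measurable_fun [set: R * d.-tuple R] (@tcons R d).
Proof. exact: measurable_cons. Qed.

Section step.
Context (d : nat) (mu : {sigma_finite_measure set (d.-tuple R) -> \bar R}).

Let nu : set (d.+1.-tuple R) -> \bar R :=
  pushforward (@lebesgue_measure R \x mu)%E (@tcons R d).

HB.instance Definition _ := Measure.copy nu
  (measure_function_pushforward__canonical__measure_function_Measure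
    (@lebesgue_measure R \x mu)%E (@measurable_tcons d)).

Let nu_sigma_finite : sigma_finite setT nu.
Proof.
have [F TF Foo] : sigma_finite setT (@lebesgue_measure R \x mu)%E.
  exact: product_measure_sigma_finite.
pose u (t : d.+1.-tuple R) : R * d.-tuple R := (thead t, [tuple of behead t]).
have uK : cancel (@tcons R d) u.
  by move=> [x t]; rewrite /u/=; congr pair; exact/val_inj.
have Ku : cancel u (@tcons R d) by move=> t; rewrite [RHS]tuple_eta.
have mu_ : measurable_fun setT u.
  apply/measurable_fun_pair => /=; first exact: measurable_tnth.
  exact: measurable_behead.
exists (fun k => u @^-1` F k).
  by rewrite -preimage_bigcup -TF preimage_setT.
move=> k; have [mF Fk] := Foo k; split.
  by rewrite -[X in measurable X]setTI; exact: mu_.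
rewrite /nu /pushforward -comp_preimage.
by rewrite (_ : u \o _ = idfun)//; exact/funext.
Qed.

HB.instance Definition _ :=
  Measure_isSigmaFinite.Build _ _ _ nu nu_sigma_finite.

Definition lebesgue_step : {sigma_finite_measure set (d.+1.-tuple R) -> \bar R} :=
  nu.
End step.

(* Lebesgue measure on the Borel sets of R^d, with R^d represented by d.-tuple R:
   a point mass for d = 0, then the product with the Lebesgue measure of R. *)
Fixpoint lebesgue_tuple d : {sigma_finite_measure set (d.-tuple R) -> \bar R} :=
  if d is d'.+1 then lebesgue_step (lebesgue_tuple d') else \d_[tuple].

Definition tsub d (y x : d.-tuple R) : d.-tuple R :=
  [tuple tnth y i - tnth x i | i < d].

Lemma measurable_tsub d (x : d.-tuple R) : measurable_fun [set: d.-tuple R] (fun y => tsub y x).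
Proof.
apply/measurable_fun_tnthP => i.
rewrite (_ : _ \o _ = fun y => tnth y i - tnth x i); last first.
  by apply/funext => y /=; rewrite tnth_mktuple.
by apply: measurable_funB => //; exact: measurable_tnth.
Qed.

Lemma lebesgue_measureB (a : R) (A : set R) : measurable A ->
  lebesgue_measure ((fun y => y - a) @^-1` A) = lebesgue_measure A.
Proof.
move=> mA.
have mf : measurable_fun setT ((fun y => y - a) : R -> measurableTypeR R).
  exact: measurable_funB.
apply/esym/(@lebesgue_measure_unique R
  (measure_function_pushforward__canonical__measure_function_Measure
    (@lebesgue_measure R) mf)) => //= _ [[b c]] _ <-.
rewrite /pushforward.
rewrite (_ : _ @^-1` _ = `]b + a, c + a]%classic); last first.
  by apply/seteqP; split => y /=; rewrite !in_itv/= ltrBrDr lerBlDr.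
rewrite !lebesgue_measure_itv/= !lte_fin ltrD2r; case: ifPn => // _.
by rewrite !EFinN -!EFinD; congr EFin; ring.
Qed.

Lemma lebesgue_tuple_translate d (x : d.-tuple R) (A : set (d.-tuple R)) :
  measurable A -> lebesgue_tuple d ((fun y => tsub y x) @^-1` A) = lebesgue_tuple d A.
Proof.
elim: d x A => [|d IH] x A mA.
  by congr (lebesgue_tuple _ _); apply/seteqP; split => y /=;
    rewrite [tsub y x]tuple0 [y]tuple0.
pose x' := [tuple of behead x].
pose phi (p : measurableTypeR R * d.-tuple R) : measurableTypeR R * d.-tuple R :=
  ((p.1 : R) - thead x, tsub p.2 x').
have mphi : measurable_fun setT phi.
  apply/measurable_fun_pair => /=; first exact: measurable_funB.
  by apply: (measurableT_comp (@measurable_tsub _ x')).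
have E p : tsub (tcons p) x = tcons (phi p).
  apply/eq_from_tnth => i; rewrite tnth_mktuple.
  case: (unliftP ord0 i) => [j ->|->]; last by rewrite !tnth0.
  by rewrite !tnthS tnth_mktuple/= [x in LHS]tuple_eta tnthS.
have mA' : measurable (@tcons R d @^-1` A).
  by rewrite -[X in measurable X]setTI; exact: measurable_tcons.
have H X : measurable X -> (@lebesgue_measure R \x lebesgue_tuple d)%E X =
    (@lebesgue_measure R \x lebesgue_tuple d)%E (phi @^-1` X).
  move: X; apply: (@product_measure_unique _ _ (measurableTypeR R) _ _ _ _
    (measure_function_pushforward__canonical__measure_function_Measure
      (@lebesgue_measure R \x lebesgue_tuple d)%E mphi)) => //= B C mB mC.
  rewrite /pushforward (_ : phi @^-1` _ = ((fun y => y - thead x) @^-1` B) `*`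
    ((fun y => tsub y x') @^-1` C))//.
  rewrite product_measure1E; first by congr (_ * _)%E;
    [exact: lebesgue_measureB|exact: IH].
  - by rewrite -[X in measurable X]setTI; apply: measurable_funB.
  - by rewrite -[X in measurable X]setTI; exact: measurable_tsub.
transitivity ((@lebesgue_measure R \x lebesgue_tuple d)%E
    (phi @^-1` (@tcons R d @^-1` A))); last exact/esym/H.
suff -> : phi @^-1` (@tcons R d @^-1` A) =
          @tcons R d @^-1` ((fun y => tsub y x) @^-1` A) by [].
by apply/funext => p /=; rewrite E.
Qed.

End lebesgue_tuple.

Notation normc := ComplexField.Normc.normc.

Lemma normc_ge0 (R : rcfType) (z : R[i]) : 0 <= normc z.
Proof. by case: z => a b; exact: sqrtr_ge0. Qed.

Section complex_fun.
Context dT (T : measurableType dT) (R : realType).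
Variable mu : {measure set T -> \bar R}.
Implicit Types f g : T -> R[i].

Definition cmeasurable f :=
  measurable_fun setT (fun x => complex.Re (f x)) /\
  measurable_fun setT (fun x => complex.Im (f x)).

Definition square_integrable f :=
  cmeasurable f /\ finite_norm mu 2%:E (fun x => normc (f x)).

Definition cintegral f : R[i] :=
  Complex (Rintegral mu setT (fun x => complex.Re (f x)))
          (Rintegral mu setT (fun x => complex.Im (f x))).

Lemma cmeasurableD f g : cmeasurable f -> cmeasurable g ->
  cmeasurable (fun x => f x + g x).
Proof.
move=> [f1 f2] [g1 g2]; split.
- rewrite (_ : (fun _ => _) = (fun x => complex.Re (f x)) \+ (fun x => complex.Re (g x))).
    exact: measurable_funD.
  by apply/funext => x /=; case: (f x) (g x) => a b [].
- rewrite (_ : (fun _ => _) = (fun x => complex.Im (f x)) \+ (fun x => complex.Im (g x))).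
    exact: measurable_funD.
  by apply/funext => x /=; case: (f x) (g x) => a b [].
Qed.

Lemma cmeasurableM f g : cmeasurable f -> cmeasurable g ->
  cmeasurable (fun x => f x * g x).
Proof.
move=> [f1 f2] [g1 g2]; split.
- rewrite (_ : (fun _ => _) =
     ((fun x => complex.Re (f x)) \* (fun x => complex.Re (g x))) \-
     ((fun x => complex.Im (f x)) \* (fun x => complex.Im (g x)))).
    by apply: measurable_funB; exact: measurable_funM.
  by apply/funext => x /=; case: (f x) (g x) => a b [].
- rewrite (_ : (fun _ => _) =
     ((fun x => complex.Re (f x)) \* (fun x => complex.Im (g x))) \+
     ((fun x => complex.Im (f x)) \* (fun x => complex.Re (g x)))).
    by apply: measurable_funD; exact: measurable_funM.
  by apply/funext => x /=; case: (f x) (g x) => a b [].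
Qed.

Lemma cmeasurableJ f : cmeasurable f -> cmeasurable (fun x => (f x)^*%C).
Proof.
move=> [f1 f2]; split.
- rewrite (_ : (fun _ => _) = (fun x => complex.Re (f x)))//.
  by apply/funext => x /=; case: (f x).
- rewrite (_ : (fun _ => _) = \- (fun x => complex.Im (f x))).
    exact: measurable_funN.
  by apply/funext => x /=; case: (f x).
Qed.

Lemma cmeasurable_cst (c : R[i]) : cmeasurable (fun=> c).
Proof. by split; exact: measurable_cst. Qed.

Lemma measurable_normc f : cmeasurable f -> measurable_fun setT (fun x => normc (f x)).
Proof.
move=> [f1 f2].
rewrite (_ : (fun _ => _) = @Num.sqrt R \o
   ((fun x => complex.Re (f x) ^+ 2) \+ (fun x => complex.Im (f x) ^+ 2))).
  apply: measurableT_comp.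
    by apply: continuous_measurable_fun; exact: sqrt_continuous.
  by apply: measurable_funD; exact: measurable_funX.
by apply/funext => x /=; case: (f x).
Qed.

Lemma square_integrable_le (h : T -> R) f : cmeasurable f ->
  (forall x, normc (f x) <= h x) -> measurable_fun setT h ->
  finite_norm mu 2%:E h -> square_integrable f.
Proof.
move=> mf fh mh; rewrite /square_integrable /finite_norm => hoo; split => //.
apply: le_lt_trans hoo; rewrite unlock /=; apply: gt0_ler_poweR => //.
- by rewrite in_itv/= leey integral_ge0// => x _; exact: poweR_ge0.
- by rewrite in_itv/= leey integral_ge0// => x _; exact: poweR_ge0.
have h0 x : 0 <= h x by exact: le_trans (normc_ge0 _) (fh x).
apply: ge0_le_integral => //.
- apply/measurable_EFinP; apply: (measurableT_comp (measurable_powR _)).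
  by apply: measurableT_comp => //; exact: measurable_normc.
- apply/measurable_EFinP; apply: (measurableT_comp (measurable_powR _)).
  exact: measurableT_comp.
- move=> x _; rewrite lee_fin ge0_ler_powR ?nnegrE ?normr_ge0//.
  by rewrite !ger0_norm ?normc_ge0.
Qed.

Lemma square_integrable0 : square_integrable (fun=> 0).
Proof.
split; first exact: cmeasurable_cst.
rewrite /finite_norm (_ : _ \o _ = cst 0) ?Lnorm0//.
by apply/funext => x; congr EFin; exact: ComplexField.Normc.normc0.
Qed.

Lemma square_integrableD f g : square_integrable f -> square_integrable g ->
  square_integrable (fun x => f x + g x).
Proof.
move=> [mf foo] [mg goo].
apply: (@square_integrable_le (fun x => normc (f x) + normc (g x))).
- exact: cmeasurableD.
- by move=> x; exact: le_normcD.
- by apply: measurable_funD; exact: measurable_normc.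
- apply: (@le_lt_trans _ _ ('N[mu]_2%:E[EFin \o (fun x => normc (f x))] +
     'N[mu]_2%:E[EFin \o (fun x => normc (g x))])%E).
    apply: (@eminkowski _ _ _ mu (fun x => normc (f x)) (fun x => normc (g x))) => //.
    + exact: measurable_normc.
    + exact: measurable_normc.
    + by rewrite lee_fin ler1n.
  exact: lte_add_pinfty.
Qed.

Lemma square_integrableZ (c : R[i]) f : square_integrable f ->
  square_integrable (fun x => c * f x).
Proof.
move=> [mf foo].
have mn := measurable_normc mf.
have p1 : (1 <= 2%:E :> \bar R)%E by rewrite lee_fin ler1n.
have fL : (fun x => normc (f x)) \in Lfun mu 2%:E by rewrite inE/=; apply/andP; split; rewrite inE.
apply: (@square_integrable_le (normc c \*: (fun x => normc (f x)))).
- exact/cmeasurableM/mf/cmeasurable_cst.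
- by move=> x /=; rewrite ComplexField.Normc.normcM.
- exact: measurable_funM.
- have := @Lfun_submod_closed _ T R mu 2%:E p1.
  move=> -[L0 H].
  have := H (normc c) _ 0 fL L0.
  rewrite addr0 inE => /andP[_]; rewrite inE.
  exact.
Qed.

End complex_fun.

Section L2.
Context dT (T : measurableType dT) (R : realType).
Variable mu : {measure set T -> \bar R}.

(* L^2(mu; C): square-integrable functions modulo equality mu-a.e. An element f
   of L2 coerces to a representative, fixed by choice. Representatives are
   measurable for the given sigma-algebra (Borel on R^d), which yields the same
   classes as measurability for its completion. *)
Record L2fun := MkL2fun {
  L2fun_val :> T -> R[i];
  L2funP : square_integrable mu L2fun_val }.

HB.instance Definition _ := gen_eqMixin L2fun.
HB.instance Definition _ := gen_choiceMixin L2fun.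

Definition L2_eq (f g : L2fun) := `[< (f : T -> R[i]) = g %[ae mu] >].

Lemma L2_eq_refl : reflexive L2_eq.
Proof. by move=> f; apply/asboolP; apply: nearW => x _. Qed.

Lemma L2_eq_sym : symmetric L2_eq.
Proof.
by move=> f g; apply/asboolP/asboolP; apply: filterS => x h /h.
Qed.

Lemma L2_eq_trans : transitive L2_eq.
Proof.
move=> f g h /asboolP gf /asboolP fh; apply/asboolP.
by apply: filterS2 gf fh => x h1 h2 ?; rewrite h1// h2.
Qed.

Canonical L2_eq_equiv := EquivRel L2_eq L2_eq_refl L2_eq_sym L2_eq_trans.

Definition L2 : Type := {eq_quot L2_eq}%qT.
HB.instance Definition _ := Choice.on L2.
HB.instance Definition _ := EqQuotient.on L2.

Definition L2_to_fun (f : L2) : T -> R[i] := repr f.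
Coercion L2_to_fun : L2 >-> Funclass.

Definition class_of f (hf : square_integrable mu f) : L2 := \pi_L2%qT (MkL2fun hf).

Lemma L2P (f : L2) : square_integrable mu f.
Proof. exact: L2funP. Qed.

Lemma class_ofE f (hf : square_integrable mu f) : class_of hf = f %[ae mu].
Proof.
have /eqP : (\pi_L2 (repr (class_of hf)) = \pi_L2 (MkL2fun hf))%qT by rewrite reprK.
by rewrite eqmodE => /asboolP.
Qed.

Lemma L2_ext (f g : L2) : (f : T -> R[i]) = g %[ae mu] -> f = g.
Proof.
move=> fg; rewrite -[f]reprK -[g]reprK; apply/eqP; rewrite eqmodE.
exact/asboolP.
Qed.

Definition L2_zero : L2 := class_of (square_integrable0 mu).
Definition L2_add (f g : L2) : L2 := class_of (square_integrableD (L2P f) (L2P g)).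
Definition L2_scale (c : R[i]) (f : L2) : L2 := class_of (square_integrableZ c (L2P f)).
Definition L2_opp (f : L2) : L2 := L2_scale (-1) f.

Lemma L2_addA : associative L2_add.
Proof.
move=> f g h; apply: L2_ext.
have H1 := class_ofE (square_integrableD (L2P f) (L2P (L2_add g h))).
have H2 := class_ofE (square_integrableD (L2P g) (L2P h)).
have H3 := class_ofE (square_integrableD (L2P (L2_add f g)) (L2P h)).
have H4 := class_ofE (square_integrableD (L2P f) (L2P g)).
near=> x => _.
rewrite (near H1 x)// (near H3 x)// (near H2 x)// (near H4 x)//.
by rewrite addrA.
Unshelve. all: by end_near. Qed.

Lemma L2_addC : commutative L2_add.
Proof.
move=> f g; apply: L2_ext.
have H1 := class_ofE (square_integrableD (L2P f) (L2P g)).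
have H2 := class_ofE (square_integrableD (L2P g) (L2P f)).
near=> x => _.
by rewrite (near H1 x)// (near H2 x)// addrC.
Unshelve. all: by end_near. Qed.

Lemma L2_add0 : left_id L2_zero L2_add.
Proof.
move=> f; apply: L2_ext.
have H1 := class_ofE (square_integrableD (L2P L2_zero) (L2P f)).
have H2 := class_ofE (square_integrable0 mu).
near=> x => _.
by rewrite (near H1 x)// (near H2 x)// add0r.
Unshelve. all: by end_near. Qed.

Lemma L2_addN : left_inverse L2_zero L2_opp L2_add.
Proof.
move=> f; apply: L2_ext.
have H1 := class_ofE (square_integrableD (L2P (L2_opp f)) (L2P f)).
have H2 := class_ofE (square_integrable0 mu).
have H3 := class_ofE (square_integrableZ (-1) (L2P f)).
near=> x => _.
by rewrite (near H1 x)// (near H2 x)// (near H3 x)// mulN1r addNr.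
Unshelve. all: by end_near. Qed.

HB.instance Definition _ :=
  GRing.isZmodule.Build L2 L2_addA L2_addC L2_add0 L2_addN.

Lemma L2_scaleA a b f : L2_scale a (L2_scale b f) = L2_scale (a * b) f.
Proof.
apply: L2_ext.
have H1 := class_ofE (square_integrableZ a (L2P (L2_scale b f))).
have H2 := class_ofE (square_integrableZ b (L2P f)).
have H3 := class_ofE (square_integrableZ (a * b) (L2P f)).
near=> x => _.
by rewrite (near H1 x)// (near H2 x)// (near H3 x)// mulrA.
Unshelve. all: by end_near. Qed.

Lemma L2_scale1 : left_id 1 L2_scale.
Proof.
move=> f; apply: L2_ext.
have H1 := class_ofE (square_integrableZ 1 (L2P f)).
near=> x => _.
by rewrite (near H1 x)// mul1r.
Unshelve. all: by end_near. Qed.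

Lemma L2_scaleDr : right_distributive L2_scale +%R.
Proof.
move=> a f g; apply: L2_ext.
have H1 := class_ofE (square_integrableZ a (L2P (f + g))).
have H2 := class_ofE (square_integrableD (L2P f) (L2P g)).
have H3 := class_ofE (square_integrableD (L2P (L2_scale a f)) (L2P (L2_scale a g))).
have H4 := class_ofE (square_integrableZ a (L2P f)).
have H5 := class_ofE (square_integrableZ a (L2P g)).
near=> x => _.
rewrite (near H1 x)// (near H2 x)// (near H3 x)// (near H4 x)// (near H5 x)//.
by rewrite mulrDr.
Unshelve. all: by end_near. Qed.

Lemma L2_scaleDl f : {morph L2_scale^~ f : a b / a + b}.
Proof.
move=> a b; apply: L2_ext.
have H1 := class_ofE (square_integrableZ (a + b) (L2P f)).
have H3 := class_ofE (square_integrableD (L2P (L2_scale a f)) (L2P (L2_scale b f))).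
have H4 := class_ofE (square_integrableZ a (L2P f)).
have H5 := class_ofE (square_integrableZ b (L2P f)).
near=> x => _.
by rewrite (near H1 x)// (near H3 x)// (near H4 x)// (near H5 x)// mulrDl.
Unshelve. all: by end_near. Qed.

HB.instance Definition _ := GRing.Zmodule_isLmodule.Build R[i] L2
  L2_scaleA L2_scale1 L2_scaleDr L2_scaleDl.

Definition inner (f g : L2) : R[i] := cintegral mu (fun x => f x * (g x)^*%C).

Definition L2norm (f : L2) : R :=
  fine ('N[mu]_(2%:E)[(fun x => (normc (f x))%:E)])%E.

Lemma innerE f : inner f f = ((L2norm f ^+ 2)%:C)%C.
Proof.
have [mf foo] := L2P f.
rewrite /inner /cintegral /real_complex_def; congr Complex; last first.
  rewrite /Rintegral integral0_eq// => x _; congr EFin.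
  by case: (f x) => a b /=; ring.
have Nf : ('N[mu]_(2%:E)[(fun x => (normc (f x))%:E)] = (L2norm f)%:E)%E.
  by rewrite fineK// ge0_fin_numE ?Lnorm_ge0//; exact: foo.
have n2 : 2%:R != 0 :> R by rewrite pnatr_eq0.
have N0 : 0 <= L2norm f by rewrite -lee_fin -Nf Lnorm_ge0.
have := poweR_Lnorm mu (fun x => (normc (f x))%:E) n2.
rewrite Nf poweR_EFin powR_mulrn// => /(congr1 fine) /= ->.
congr fine; apply: eq_integral => x _ /=.
rewrite powR_mulrn ?normr_ge0// real_normK ?num_real//.
case: (f x) => a b /=.
by rewrite sqr_sqrtr ?addr_ge0 ?sqr_ge0//; congr EFin; ring.
Qed.

(* Bounded sequences have images with a norm-convergent subsequence; this is
   meant for linear A, and then entails that A is bounded. *)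
Definition compact_operator (A : L2 -> L2) :=
  forall u : nat -> L2, (exists M : R, forall n, L2norm (u n) <= M) ->
  exists (s : nat -> nat) (g : L2), {homo s : m n / (m < n)%N} /\
    (fun n => L2norm (A (u (s n)) - g)) @ \oo --> (0 : R).

(* In R[i], 0 <= w means that w is real and nonnegative. *)
Definition positive_operator (A : L2 -> L2) := forall f, 0 <= inner (A f) f.

(* Weak convergence is tested against every g, by Riesz representation. *)
Definition weakly_cvg (u : nat -> L2) (f : L2) :=
  forall g, (fun n => inner (u n) g : R[i]^o) @ \oo --> (inner f g : R[i]^o).

(* The Hilbert adjoint: <A f, g> = <f, adjoint A g>. Such a vector is unique when
   it exists; 0 is a dummy value otherwise. *)
Definition adjoint (A : L2 -> L2) (g : L2) : L2 :=
  xget 0 [set h | forall f, inner (A f) g = inner f h].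

End L2.

Section inner_ae.
Context dT (T : measurableType dT) (R : realType).
Variable mu : {measure set T -> \bar R}.

Lemma cintegral_ae (f g : T -> R[i]) : cmeasurable f -> cmeasurable g ->
  f = g %[ae mu] -> cintegral mu f = cintegral mu g.
Proof.
move=> [f1 f2] [g1 g2] fg; congr Complex; congr fine; apply: ae_eq_integral => //.
- exact/measurable_EFinP.
- exact/measurable_EFinP.
- by apply: filterS fg => x h ?; rewrite h.
- exact/measurable_EFinP.
- exact/measurable_EFinP.
- by apply: filterS fg => x h ?; rewrite h.
Qed.

End inner_ae.

Section euclidean.
Context (R : realType) (d : nat).
Notation E := (d.-tuple R).
Notation lambda := (lebesgue_tuple R d).

Definition dotp (x y : E) : R := \sum_(i < d) tnth x i * tnth y i.

Definition expi (t : R) : R[i] := Complex (cos t) (sin t).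

Lemma integral_translate (x : E) (h : E -> \bar R) : measurable_fun setT h ->
  (\int[lambda]_y h (tsub y x) = \int[lambda]_y h y)%E.
Proof.
have mphi : measurable_fun [set: E] (fun y => tsub y x).
  exact: measurable_tsub.
have ge0 (k : E -> \bar R) : measurable_fun setT k -> (forall y, 0 <= k y)%E ->
    (\int[lambda]_y k (tsub y x) = \int[lambda]_y k y)%E.
  move=> mk k0.
  have := @ge0_integral_pushforward _ _ _ _ R _ mphi lambda setT k measurableT mk
    (fun y _ => k0 y).
  rewrite preimage_setT => <-.
  by apply: eq_measure_integral => A mA _; exact: lebesgue_tuple_translate.
move=> mh; rewrite [LHS]integralE [RHS]integralE; congr (_ - _)%E.
- rewrite -(ge0 _ (measurable_funepos mh) (funepos_ge0 h)).
  by apply: eq_integral => y _; rewrite !funeposE.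
- rewrite -(ge0 _ (measurable_funeneg mh) (funeneg_ge0 h)).
  by apply: eq_integral => y _; rewrite !funenegE.
Qed.

Lemma measurable_dotp (x : E) : measurable_fun setT (dotp x).
Proof.
rewrite /dotp; apply: measurable_sum => i.
by apply: measurable_funM => //; exact: measurable_tnth.
Qed.

Lemma cmeasurable_expi (x : E) (c : R) : cmeasurable (fun y => expi (c * dotp x y)).
Proof.
have m : measurable_fun [set: E] (fun y => c * dotp x y).
  by apply: measurable_funM => //; exact: measurable_dotp.
split => /=.
- apply: (measurableT_comp _ m).
  by apply: continuous_measurable_fun; exact: continuous_cos.
- apply: (measurableT_comp _ m).
  by apply: continuous_measurable_fun; exact: continuous_sin.
Qed.

Lemma cmeasurable_translate (x : E) (f : E -> R[i]) :
  cmeasurable f -> cmeasurable (fun y => f (tsub y x)).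
Proof.
by move=> [f1 f2]; split; [apply: (measurableT_comp f1)|apply: (measurableT_comp f2)];
  exact: measurable_tsub.
Qed.

Lemma normc_expi t : normc (expi t) = 1.
Proof. by rewrite /= cos2Dsin2 sqrtr1. Qed.

Lemma square_integrable_mod (u f : E -> R[i]) (x : E) :
  cmeasurable u -> (forall y, normc (u y) = 1) -> square_integrable lambda f ->
  square_integrable lambda (fun y => u y * f (tsub y x)).
Proof.
move=> mu u1 [mf foo].
have m1 := cmeasurable_translate x mf.
have mn : measurable_fun setT (fun y => normc (f y)) by exact: measurable_normc.
apply: (@square_integrable_le _ _ _ _ (fun y => normc (f (tsub y x)))).
- exact: cmeasurableM.
- by move=> y; rewrite ComplexField.Normc.normcM u1 mul1r.
- exact: measurable_normc.
- move: foo; rewrite /finite_norm unlock.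
  rewrite -(@integral_translate x (fun y => `|(normc (f y))%:E| `^ 2)%E)//.
  apply/measurable_EFinP; apply: (measurableT_comp (measurable_powR _)).
  exact: measurableT_comp.
Qed.

Definition tf_shift (z : E * E) (f : E -> R[i]) : E -> R[i] :=
  fun y => expi (2 * pi * dotp z.2 y) * f (tsub y z.1).

Lemma square_integrable_tf_shift z f : square_integrable lambda f ->
  square_integrable lambda (tf_shift z f).
Proof.
apply: square_integrable_mod; first exact: cmeasurable_expi.
by move=> y; exact: normc_expi.
Qed.

Notation L2R := (L2 lambda).

Definition pi_op (z : E * E) (f : L2R) : L2R :=
  class_of (square_integrable_tf_shift z (L2P f)).

Lemma ae_translate (x : E) (P : E -> Prop) :
  {ae lambda, forall y, P y} -> {ae lambda, forall y, P (tsub y x)}.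
Proof.
move=> [A [mA A0 PA]]; exists ((fun y => tsub y x) @^-1` A); split.
- by rewrite -[X in measurable X]setTI; exact: measurable_tsub.
- by rewrite -A0; exact: lebesgue_tuple_translate.
- by move=> y /= nP; exact: PA.
Qed.

(* pi_op does not depend on the representative. *)
Lemma pi_op_class z f (hf : square_integrable lambda f) :
  pi_op z (class_of hf) = class_of (square_integrable_tf_shift z hf).
Proof.
apply: L2_ext.
have H1 := class_ofE (square_integrable_tf_shift z (L2P (class_of hf))).
have H2 := class_ofE (square_integrable_tf_shift z hf).
have H3 := ae_translate z.1 (class_ofE hf).
near=> y => _.
rewrite (near H1 y)// (near H2 y)// /tf_shift; congr (_ * _).
exact: (near H3 y).
Unshelve. all: by end_near. Qed.

Lemma cintegral_translate (x : E) (h : E -> R[i]) : cmeasurable h ->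
  cintegral lambda (fun y => h (tsub y x)) = cintegral lambda h.
Proof.
move=> [h1 h2]; congr Complex; congr fine.
- by apply: (@integral_translate x (EFin \o (fun y => complex.Re (h y)))); exact/measurable_EFinP.
- by apply: (@integral_translate x (EFin \o (fun y => complex.Im (h y)))); exact/measurable_EFinP.
Qed.

Lemma inner_adjoint_pi z f g :
  inner (pi_op z f) g = inner f (adjoint (pi_op z) g).
Proof.
suff : exists h, forall f, inner (pi_op z f) g = inner f h.
  move=> [h hP]; rewrite /adjoint; case: xgetP => [k _ /= ->//|].
  by move=> /(_ h).
case: z => x xi.
pose o : E := tsub [tuple 0 | _ < d] x.
have xo y : tsub (tsub y x) o = y.
  by apply: eq_from_tnth => i; rewrite !tnth_mktuple; ring.
pose u (y : E) : R[i] := ((expi (2 * pi * dotp xi (tsub y o)))^*)%C.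
have mu_ : cmeasurable u.
  by apply: cmeasurableJ; apply: (cmeasurable_translate o (cmeasurable_expi xi (2 * pi))).
have u1 y : normc (u y) = 1 by rewrite /= sqrrN cos2Dsin2 sqrtr1.
have H := square_integrable_mod o mu_ u1 (L2P g).
exists (class_of H) => {}f.
have [mf _] := L2P f; have [mg _] := L2P g.
have [mpf _] := L2P (pi_op (x, xi) f); have [mB _] := L2P (class_of H).
have mBg : cmeasurable (fun y => u y * g (tsub y o)) := H.1.
have mt : cmeasurable (tf_shift (x, xi) f).
  exact: (square_integrable_tf_shift (x, xi) (L2P f)).1.
transitivity (cintegral lambda (fun y => tf_shift (x, xi) f y * (g y)^*%C)).
  apply: cintegral_ae.
  - by apply: cmeasurableM => //; exact: cmeasurableJ.
  - by apply: cmeasurableM => //; exact: cmeasurableJ.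
  have H1 := class_ofE (square_integrable_tf_shift (x, xi) (L2P f)).
  by apply: filterS H1 => y h ?; rewrite h.
transitivity (cintegral lambda (fun y => f y * (u y * g (tsub y o))^*%C)); last first.
  apply: cintegral_ae.
  - by apply: cmeasurableM => //; exact: cmeasurableJ.
  - by apply: cmeasurableM => //; exact: cmeasurableJ.
  by apply: filterS (class_ofE H) => y h ?; rewrite h.
have JM (a b : R[i]) : ((a * b)^*)%C = (a^*)%C * (b^*)%C := rmorphM _ a b.
rewrite -(@cintegral_translate x (fun y => f y * (u y * g (tsub y o))^*%C)).
  congr cintegral; apply/funext => y.
  rewrite JM /u conjcK !xo mulrA; congr (_ * _).
  exact: mulrC.
by apply: cmeasurableM => //; exact: cmeasurableJ.
Qed.

Definition alpha (z : E * E) (S : L2R -> L2R) : L2R -> L2R :=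
  pi_op z \o S \o adjoint (pi_op z).

Definition Q (S : L2R -> L2R) (f : L2R) (z : E * E) : R[i] := inner (alpha z S f) f.

Definition phase_measure : {measure set (E * E)%type -> \bar R} :=
  (lambda \x lambda)%E.

(* Lebesgue measure on R^{2d}, completed so that Lebesgue measurable sets, and
   not only Borel ones, are allowed. *)
Definition volume : set _ -> \bar R :=
  @completed_measure_extension _ _ R phase_measure.

HB.instance Definition _ := Measure.on volume.

Definition lebesgue_measurable (Omega : set (E * E)) :=
  (phase_measure^*)%mu.-cara.-measurable Omega.

Definition LpNorm (Omega : set (E * E)) (p : R) (F : E * E -> R[i]) : \bar R :=
  ('N[volume]_(p%:E)[(fun z => (normc (F z))%:E) \_ Omega])%E.

Definition LpQ_ratio Omega p (S : L2R -> L2R) (f : L2R) : \bar R :=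
  (LpNorm Omega p (Q S f) * ((L2norm f ^+ 2)^-1)%:E)%E.

Definition Lambda Omega p (S : L2R -> L2R) : \bar R :=
  ereal_sup [set LpQ_ratio Omega p S f | f in [set f | f != 0]].

End euclidean.

Notation L2Rd R d := (L2 (lebesgue_tuple R d)).

(* Main.v *)
Require Import Defs.
From mathcomp Require Import all_boot all_order all_algebra.
From mathcomp Require Import complex.
From mathcomp Require Import all_classical all_reals all_analysis.
From mathcomp Require Import ring lra measurable_realfun.
Import Order.TTheory GRing.Theory Num.Theory.
Import numFieldNormedType.Exports.
Local Open Scope classical_set_scope.
Local Open Scope ring_scope.

(* Since pi(z) is unitary, Q_S f(z) = c |f|^2 + q(pi(z)^* f) with q(h) = <S_0 h, h>.
   Positivity makes S_0 symmetric, and compactness makes q, on each ball, a uniform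
   limit of finite maxima of weakly continuous affine functionals. Hence q is weakly
   continuous and bounded on balls, and z |-> q(pi(z)^* f) is measurable because
   z |-> <pi(z)^* f, g> is, by Fubini. Dominated convergence over Omega then gives
   the limit of the norms.

   A maximizing sequence of unit vectors has a subsequence converging weakly to some
   f with |f| <= 1, so Lambda is the norm of c + Q_{S_0} f. Normalizing f (or taking
   any unit vector if f = 0) can only increase this function pointwise. *)

Set Implicit Arguments.
Unset Strict Implicit.
Unset Printing Implicit Defensive.

(** * The inner product of L2 *)

Section inner_product.
Context dT (T : measurableType dT) (R : realType).
Variable mu : {measure set T -> \bar R}.
Local Notation L2 := (L2 mu).
Implicit Types (f g h : L2) (u v w : T -> R[i]).

(** The obstacle is that the norm is not weakly continuous: [c |f_n|^2] stays equal to [c] while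
    [c |f|^2] may be smaller, and the correction [c (1 - |f|^2)] is exactly this lost mass. No
    spectral decomposition is used for [S_0]. Expanding [q(h - g) >= 0] shows that
    [2 Re <h, S_0 g> - q(g)], the tangent of [q] at [g], lies below [q], with a gap controlled by
    [|S_0 h - S_0 g|]. The image of a ball under [S_0] is totally bounded, so finitely many tangents
    suffice there; this one approximation yields continuity, boundedness and measurability. Weak
    sequential compactness holds for an arbitrary measure, without separability: an ultrafilter
    supplies limits against all test vectors at once, Riesz representation turns them into a vector,
    and only then is a subsequence extracted. Riesz representation in turn rests on the completeness
    of [L2]. *)

Lemma L2_addE f g : ((f + g : L2) : T -> R[i]) = (fun x => f x + g x) %[ae mu].
Proof. exact: class_ofE. Qed.

Lemma L2_scaleE a f : ((a *: f : L2) : T -> R[i]) = (fun x => a * f x) %[ae mu].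
Proof. exact: class_ofE. Qed.

Lemma L2_zeroE : ((0 : L2) : T -> R[i]) = (fun=> 0) %[ae mu].
Proof. exact: class_ofE. Qed.

Lemma integrable_normc_sq u : square_integrable mu u ->
  mu.-integrable setT (EFin \o (fun x => normc (u x) ^+ 2)).
Proof.
move=> [mu_ uoo]; apply/integrableP; split.
  by apply/measurable_EFinP; apply: measurable_funX; exact: measurable_normc.
have n2 : 2%:R != 0 :> R by rewrite pnatr_eq0.
have := poweR_Lnorm mu (fun x => (normc (u x))%:E) n2.
rewrite (_ : integral _ _ _ = (\int[mu]_x `|(normc (u x) ^+ 2)%:E|)%E); last first.
  apply: eq_integral => x _.
  by rewrite poweR_EFin powR_mulrn ?normr_ge0// -normrX.
by move=> <-; apply: poweR_lty; exact: uoo.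
Qed.

Lemma Re_le_normc (z : R[i]) : `|complex.Re z| <= normc z.
Proof.
case: z => a b /=; rewrite -sqrtr_sqr ler_wsqrtr// lerDl sqr_ge0//.
Qed.

Lemma Im_le_normc (z : R[i]) : `|complex.Im z| <= normc z.
Proof.
case: z => a b /=; rewrite -sqrtr_sqr ler_wsqrtr// lerDr sqr_ge0//.
Qed.

Definition cintegrable u :=
  mu.-integrable setT (EFin \o (fun x => complex.Re (u x))) /\
  mu.-integrable setT (EFin \o (fun x => complex.Im (u x))).

Lemma normc_conj (z : R[i]) : normc (z^*%C) = normc z.
Proof. by case: z => a b /=; rewrite sqrrN. Qed.

(** The pointwise bound [|u v| <= |u|^2 + |v|^2] dominates the real and the imaginary part. *)
Lemma cintegrableM u v : square_integrable mu u -> square_integrable mu v ->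
  cintegrable (fun x => u x * (v x)^*%C).
Proof.
move=> su sv; have [m1 m2] := cmeasurableM su.1 (cmeasurableJ sv.1).
have Huv := integrableD measurableT (integrable_normc_sq su) (integrable_normc_sq sv).
have le x : normc (u x * (v x)^*%C) <= normc (u x) ^+ 2 + normc (v x) ^+ 2.
  rewrite ComplexField.Normc.normcM normc_conj.
  have := normc_ge0 (u x); have := normc_ge0 (v x); nra.
split; (apply: (le_integrable measurableT _ _ Huv); first exact/measurable_EFinP).
- move=> x _ /=; rewrite lee_fin (le_trans (Re_le_normc _))// (le_trans (le x))//.
  exact: ler_norm.
- move=> x _ /=; rewrite lee_fin (le_trans (Im_le_normc _))// (le_trans (le x))//.
  exact: ler_norm.
Qed.

Lemma cintegralD u v : cintegrable u -> cintegrable v ->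
  cintegral mu (fun x => u x + v x) = cintegral mu u + cintegral mu v.
Proof.
move=> [u1 u2] [v1 v2]; rewrite /cintegral.
rewrite (_ : _ + _ = Complex
  (Rintegral mu setT (fun x => complex.Re (u x)) +
   Rintegral mu setT (fun x => complex.Re (v x)))
  (Rintegral mu setT (fun x => complex.Im (u x)) +
   Rintegral mu setT (fun x => complex.Im (v x))))//.
congr Complex; rewrite -RintegralD//; apply: eq_Rintegral => x _;
  by case: (u x) (v x) => a b [].
Qed.

Lemma cintegralZ (c : R[i]) u : cintegrable u ->
  cintegral mu (fun x => c * u x) = c * cintegral mu u.
Proof.
case: c => a b [u1 u2].
rewrite /cintegral [RHS](_ : _ = Complex
  (a * Rintegral mu setT (fun x => complex.Re (u x)) -
   b * Rintegral mu setT (fun x => complex.Im (u x)))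
  (a * Rintegral mu setT (fun x => complex.Im (u x)) +
   b * Rintegral mu setT (fun x => complex.Re (u x))))//.
have i1 k : mu.-integrable setT (EFin \o (fun x => k * complex.Re (u x))).
  by apply: (integrableZl measurableT k u1).
have i2 k : mu.-integrable setT (EFin \o (fun x => k * complex.Im (u x))).
  by apply: (integrableZl measurableT k u2).
congr Complex; rewrite -!RintegralZl//.
- rewrite -RintegralB//; apply: eq_Rintegral => x _; by case: (u x).
- rewrite -RintegralD//; apply: eq_Rintegral => x _; case: (u x) => s t //=.
Qed.

Lemma innerDl f g h : inner (f + g) h = inner f h + inner g h.
Proof.
rewrite /inner -cintegralD; [|exact: cintegrableM (L2P _) (L2P _)..].
apply: cintegral_ae.
- exact: cmeasurableM (L2P _).1 (cmeasurableJ (L2P _).1).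
- by apply: cmeasurableD; exact: cmeasurableM (L2P _).1 (cmeasurableJ (L2P _).1).
- by apply: filterS (L2_addE f g) => x E _; rewrite E// mulrDl.
Qed.

Lemma innerZl a f h : inner (a *: f) h = a * inner f h.
Proof.
rewrite /inner -cintegralZ; last exact: cintegrableM (L2P _) (L2P _).
apply: cintegral_ae.
- exact: cmeasurableM (L2P _).1 (cmeasurableJ (L2P _).1).
- apply: (cmeasurableM (cmeasurable_cst _ _)).
  exact: cmeasurableM (L2P _).1 (cmeasurableJ (L2P _).1).
- by apply: filterS (L2_scaleE a f) => x E _; rewrite E// mulrA.
Qed.

Lemma inner_conj f g : inner g f = (inner f g)^*%C.
Proof.
rewrite /inner /cintegral /=; congr Complex.
  by apply: eq_Rintegral => x _; case: (f x) (g x) => a b [c e] /=; ring.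
have [_ i2] := cintegrableM (L2P f) (L2P g).
rewrite -[RHS]mulN1r -RintegralZl//; apply: eq_Rintegral => x _.
by case: (f x) (g x) => a b [c e] /=; ring.
Qed.

(** The inner product of the underlying real Hilbert space. Norms are read off from it, and
    [Im_inner] recovers the imaginary part, so most arguments can stay over the reals. *)
Definition rinner f g : R := complex.Re (inner f g).

Lemma rinnerC f g : rinner f g = rinner g f.
Proof. by rewrite /rinner (inner_conj g f); case: (inner g f). Qed.

Lemma rinnerDl f g h : rinner (f + g) h = rinner f h + rinner g h.
Proof. by rewrite /rinner innerDl; case: (inner f h) (inner g h) => a b []. Qed.

Lemma rinnerDr f g h : rinner f (g + h) = rinner f g + rinner f h.
Proof. by rewrite rinnerC rinnerDl !(rinnerC f). Qed.

Lemma rinnerZl (a : R) f h : rinner (a%:C%C *: f) h = a * rinner f h.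
Proof. by rewrite /rinner innerZl; case: (inner f h) => b c /=; rewrite mul0r subr0. Qed.

Lemma rinnerZr (a : R) f h : rinner f (a%:C%C *: h) = a * rinner f h.
Proof. by rewrite rinnerC rinnerZl rinnerC. Qed.

Lemma real_complexN1 : ((-1 : R)%:C)%C = -1 :> R[i].
Proof. by rewrite rmorphN1. Qed.

Lemma rinnerNl f h : rinner (- f) h = - rinner f h.
Proof.
by rewrite -scaleN1r -real_complexN1 rinnerZl mulN1r.
Qed.

Lemma rinnerNr f h : rinner f (- h) = - rinner f h.
Proof. by rewrite rinnerC rinnerNl rinnerC. Qed.

Lemma rinnerBl f g h : rinner (f - g) h = rinner f h - rinner g h.
Proof. by rewrite rinnerDl rinnerNl. Qed.

Lemma rinnerBr f g h : rinner f (g - h) = rinner f g - rinner f h.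
Proof. by rewrite rinnerDr rinnerNr. Qed.

Lemma rinner_norm f : rinner f f = L2norm f ^+ 2.
Proof. by rewrite /rinner innerE. Qed.

Lemma L2norm_ge0 f : 0 <= L2norm f.
Proof. by rewrite fine_ge0// Lnorm_ge0. Qed.

Lemma rinner_ge0 f : 0 <= rinner f f.
Proof. by rewrite rinner_norm sqr_ge0. Qed.

Lemma Im_inner f g : complex.Im (inner f g) = rinner f ('i%C *: g).
Proof.
rewrite /rinner (inner_conj ('i%C *: g) f) innerZl (inner_conj f g).
by case: (inner f g) => a b /=; ring.
Qed.

(** Serves twice: for Cauchy-Schwarz, and in [L2_riesz] to turn near-minimality along a line into a
    bound on the linear coefficient. *)
Lemma quadratic_ge0_discr (a b c : R) : 0 <= c ->
  (forall t, 0 <= a + t * (2 * b) + t ^+ 2 * c) -> b ^+ 2 <= a * c.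
Proof.
rewrite le_eqVlt => /orP[/eqP <-|c0] H.
  rewrite mulr0; case: (eqVneq b 0) => [->|n0]; first by rewrite expr0n.
  (* With [c = 0] and [b != 0], this choice of [t] would give the value [-1]. *)
  have := H (- (a + 1) / (2 * b)).
  rewrite mulr0 addr0 -mulrA mulVf ?mulf_neq0 ?pnatr_eq0//; lra.
have {}c0' : c != 0 by rewrite gt_eqF.
(* The value at the vertex [t = - b / c], multiplied by [c]. *)
rewrite -subr_ge0 (_ : _ - _ = c * (a + - b / c * (2 * b) + (- b / c) ^+ 2 * c)).
  by rewrite mulr_ge0// ltW.
by field.
Qed.

Lemma rinner_sqr_le f g : rinner f g ^+ 2 <= rinner f f * rinner g g.
Proof.
apply: (quadratic_ge0_discr (rinner_ge0 g)) => t.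
have := rinner_ge0 (f + t%:C%C *: g).
rewrite rinnerDl !rinnerDr !rinnerZl !rinnerZr (rinnerC g f) => /le_trans; apply.
by rewrite le_eqVlt; apply/orP; left; apply/eqP; ring.
Qed.

Lemma rinner_le f g : `|rinner f g| <= L2norm f * L2norm g.
Proof.
rewrite -(@ler_pXn2r _ 2)// ?nnegrE ?mulr_ge0 ?L2norm_ge0//.
by rewrite real_normK ?num_real// exprMn -!rinner_norm rinner_sqr_le.
Qed.

Lemma L2norm_eq0 f : L2norm f = 0 -> f = 0.
Proof.
move=> f0; apply: L2_ext.
have [mf foo] := L2P f.
have : ('N[mu]_(2%:E)[(fun x => (normc (f x))%:E)] = 0)%E.
  have := f0; rewrite /L2norm => /eqP; rewrite fine_eq0; first by move=> /eqP.
  by rewrite ge0_fin_numE ?Lnorm_ge0//; exact: foo.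
move=> /Lnorm_eq0_eq0 []; [|by rewrite lte_fin|move=> N [mN N0 sN]].
- by apply/measurable_EFinP; exact: measurable_normc.
apply: filterS2 L2_zeroE (_ : {ae mu, forall x, normc (f x) = 0}).
  by move=> x E /ComplexField.Normc.eq0_normc -> _; rewrite E.
exists N; split => // x /= nx; apply: sN => /= H; apply: nx.
by have /(congr1 fine) := H I.
Qed.

Lemma L2norm0 : L2norm (0 : L2) = 0.
Proof.
apply/eqP; rewrite -sqrf_eq0 -rinner_norm.
by rewrite -(scale0r 0) (_ : 0 = (0%:C)%C)// rinnerZl mul0r.
Qed.

Lemma L2normZ (a : R) f : L2norm (a%:C%C *: f) = `|a| * L2norm f.
Proof.
apply/eqP; rewrite -(@eqrXn2 _ 2)// ?mulr_ge0 ?L2norm_ge0//.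
by rewrite exprMn -!rinner_norm rinnerZl rinnerZr real_normK ?num_real// mulrA.
Qed.

Lemma L2normD f g : L2norm (f + g) <= L2norm f + L2norm g.
Proof.
rewrite -(@ler_pXn2r _ 2)// ?nnegrE ?addr_ge0 ?L2norm_ge0//.
rewrite -rinner_norm rinnerDl !rinnerDr (rinnerC g f) !rinner_norm.
have := rinner_le f g; rewrite ler_norml => /andP[_]; nra.
Qed.

Lemma L2normN f : L2norm (- f) = L2norm f.
Proof.
by rewrite -scaleN1r -real_complexN1 L2normZ normrN1 mul1r.
Qed.

Lemma L2_gt0 f : f != 0 -> 0 < L2norm f.
Proof.
move=> f0; rewrite lt_neqAle L2norm_ge0 andbT eq_sym; apply: contra f0 => /eqP.
by move=> /L2norm_eq0 ->.
Qed.

End inner_product.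

(** * Completeness of L2 *)

Section completeness.
Context dT (T : measurableType dT) (R : realType).
Variable mu : {measure set T -> \bar R}.
Local Notation L2 := (L2 mu).
Implicit Types (f g h : L2) (u v w : T -> R[i]).

Lemma L2norm_sqE f : ((L2norm f ^+ 2)%:E = \int[mu]_x (normc (f x) ^+ 2)%:E)%E.
Proof.
have [mf foo] := L2P f.
have Nf : ('N[mu]_(2%:E)[(fun x => (normc (f x))%:E)] = (L2norm f)%:E)%E.
  by rewrite fineK// ge0_fin_numE ?Lnorm_ge0//; exact: foo.
have n2 : 2%:R != 0 :> R by rewrite pnatr_eq0.
have := poweR_Lnorm mu (fun x => (normc (f x))%:E) n2.
rewrite Nf poweR_EFin powR_mulrn ?L2norm_ge0// => ->.
apply: eq_integral => x _.
by rewrite /= powR_mulrn ?normr_ge0// ger0_norm// normc_ge0.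
Qed.

Lemma square_integrable_lty u : cmeasurable u ->
  (\int[mu]_x (normc (u x) ^+ 2)%:E < +oo)%E -> square_integrable mu u.
Proof.
move=> mu_ uoo; split => //; rewrite /finite_norm unlock /=.
apply: poweR_lty; apply: le_lt_trans uoo.
rewrite le_eqVlt; apply/orP; left; apply/eqP; apply: eq_integral => x _.
by rewrite /= powR_mulrn ?normr_ge0// ger0_norm// normc_ge0.
Qed.

Lemma measurable_normc_sq u : cmeasurable u ->
  measurable_fun setT (fun x => (normc (u x) ^+ 2)%:E).
Proof.
by move=> mu_; apply/measurable_EFinP; apply: measurable_funX; exact: measurable_normc.
Qed.

Lemma cmeasurableB u v : cmeasurable u -> cmeasurable v ->
  cmeasurable (fun x => u x - v x).
Proof.
move=> mu_ mv; rewrite (_ : (fun _ => _) = (fun x => u x + (-1) * v x)).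
  by apply: cmeasurableD => //; apply: cmeasurableM => //; exact: cmeasurable_cst.
by apply/funext => x; rewrite mulN1r.
Qed.

Lemma L2_subE f g : ((f - g : L2) : T -> R[i]) = (fun x => f x - g x) %[ae mu].
Proof.
rewrite -scaleN1r; apply: filterS2 (L2_addE f (-1 *: g)) (L2_scaleE (-1) g) => x E1 E2 _.
by rewrite E1// E2// mulN1r.
Qed.

(** Leaving the representative [v] free lets [L2_complete] work with its explicit pointwise limit
    instead of the representative picked by the quotient. *)
Lemma L2norm_sub_ae f g v : cmeasurable v -> (f : T -> R[i]) = v %[ae mu] ->
  ((L2norm (f - g) ^+ 2)%:E = \int[mu]_x (normc (v x - g x) ^+ 2)%:E)%E.
Proof.
move=> mv fv; rewrite L2norm_sqE; apply: ae_eq_integral => //.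
- exact: measurable_normc_sq (L2P _).1.
- by apply: measurable_normc_sq; apply: cmeasurableB => //; exact: (L2P _).1.
- by apply: filterS2 (L2_subE f g) fv => x E1 E2 _; rewrite E1// E2.
Qed.

Lemma L2norm_sub f g :
  ((L2norm (f - g) ^+ 2)%:E = \int[mu]_x (normc (f x - g x) ^+ 2)%:E)%E.
Proof. by apply: L2norm_sub_ae; [exact: (L2P f).1|exact: nearW]. Qed.

(* [|d| <= 2^-n + 2^n d^2] makes the weighted square sum control the total variation. *)
Lemma cvgn_weighted_increments (a : nat -> R) (B : R) :
  (forall N, \sum_(0 <= n < N) 2 ^+ n * (a n.+1 - a n) ^+ 2 <= B) -> cvgn a.
Proof.
move=> aB.
suff cs : cvgn (series (telescope a)).
  rewrite (_ : a = (fun n => a 0%N + series (telescope a) n)).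
    by apply: is_cvgD => //; exact: is_cvg_cst.
  by apply/funext => n; exact: eq_sum_telescope.
apply: normed_cvg; apply: nondecreasing_is_cvgn.
  by apply: nondecreasing_series => n _ _; exact: normr_ge0.
exists (2 + B) => _ [N _ <-].
have le n : `|telescope a n| <= 2^-1 ^+ n + 2 ^+ n * (a n.+1 - a n) ^+ 2.
  rewrite /telescope; set d := a _ - _.
  have p0 : 0 < 2 ^+ n :> R by rewrite exprn_gt0.
  have d2 : `|d| ^+ 2 = d ^+ 2 by rewrite real_normK ?num_real.
  rewrite exprVn -d2 -subr_ge0.
  rewrite (_ : _ - _ = ((2 ^+ n * `|d| - 2^-1) ^+ 2 + 3 / 4) / 2 ^+ n).
    apply: divr_ge0; last exact: ltW.
    by rewrite addr_ge0 ?sqr_ge0// divr_ge0.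
  by field; rewrite gt_eqF.
apply: le_trans (_ : \sum_(0 <= n < N) (2^-1 ^+ n + 2 ^+ n * (a n.+1 - a n) ^+ 2) <= _).
  by rewrite /= seriesEnat; apply: ler_sum => n _; exact: le.
rewrite big_split/= lerD//.
have := @geometric_seriesE R 1 2^-1.
rewrite invr_eq1 => /(_ _)/= E.
have -> : \sum_(0 <= n < N) (2^-1 : R) ^+ n = series (geometric 1 2^-1) N.
  by rewrite seriesEnat; apply: eq_bigr => n _; rewrite /= mul1r.
rewrite E ?pnatr_eq1//=.
have : 0 <= (2^-1 : R) ^+ N by rewrite exprn_ge0.
have -> : 1 - 2^-1 = 2^-1 :> R by field.
rewrite invrK mul1r; lra.
Qed.

Lemma limn_einf_le (v : nat -> \bar R) (C : \bar R) :
  (forall n, v n <= C)%E -> (limn_einf v <= C)%E.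
Proof.
move=> vC; rewrite limn_einf_lim; apply: lime_le; first exact: is_cvg_einfs.
apply: nearW => n; apply: le_trans (vC n); apply: ereal_inf_lbound.
by exists n => /=.
Qed.

(** Riesz-Fischer. Since [2 ^ n * 4^-1 ^ n] is summable, the weighted squared increments have a
    finite sum almost everywhere, so [g n x] converges there; Fatou then transfers the rate to the
    limit. The geometric rate is part of the hypothesis, so no subsequence has to be chosen. *)
Lemma L2_complete (g : nat -> L2) :
  (forall n m, (n <= m)%N -> L2norm (g m - g n) ^+ 2 <= 4^-1 ^+ n) ->
  exists f, forall n, L2norm (f - g n) ^+ 2 <= 4^-1 ^+ n.
Proof.
move=> gC.
have mg n : cmeasurable (g n) := (L2P (g n)).1.
pose H n x := (2 ^+ n * normc (g n.+1 x - g n x) ^+ 2)%:E.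
have H0 n x : (0 <= H n x)%E by rewrite lee_fin mulr_ge0 ?sqr_ge0 ?exprn_ge0.
have mH n : measurable_fun setT (H n).
  apply/measurable_EFinP; apply: measurable_funM => //.
  by apply: measurable_funX; apply: measurable_normc; exact: cmeasurableB.
(* The bound is [2^-n], written in the shape summed by [cvg_geometric_eseries_half]. *)
have intH n : (\int[mu]_x H n x <= (2 / (2 ^ (n + 1))%:R)%:E)%E.
  rewrite /H; under eq_integral do rewrite EFinM.
  rewrite ge0_integralZl//; last 2 first.
  - by apply: measurable_normc_sq; exact: cmeasurableB.
  - by move=> x _; rewrite lee_fin sqr_ge0.
  rewrite -L2norm_sub.
  rewrite -EFinM lee_fin.
  apply: le_trans (_ : 2 ^+ n * 4^-1 ^+ n <= _).
    by rewrite ler_wpM2l ?exprn_ge0// gC.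
  rewrite natrX addn1 exprS invfM mulrA divff// mul1r -exprMn.
  rewrite le_eqVlt; apply/orP; left; apply/eqP; rewrite -exprVn; congr (_ ^+ _).
  by field.
have mSH : measurable_fun setT (fun x => \sum_(n <oo) H n x)%E.
  apply: ge0_emeasurable_sum => // k x _ _; exact: H0.
have ioo : (\int[mu]_x \sum_(n <oo) H n x < +oo)%E.
  rewrite integral_nneseries//.
  apply: (@le_lt_trans _ _ (\sum_(n <oo) (2 / (2 ^ (n + 1))%:R)%:E)%E).
    apply: lee_nneseries => [n _ _|n _]; last exact: intH.
    by apply: integral_ge0 => x _; exact: H0.
  have /cvg_lim := @cvg_geometric_eseries_half R 2 0.
  by move=> /(_ (@ereal_hausdorff R)) ->; rewrite ltry.
have aeH : {ae mu, forall x, (\sum_(n <oo) H n x < +oo)%E}.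
  have : mu.-integrable setT (fun x => \sum_(n <oo) H n x)%E.
    apply/integrableP; split => //.
    under eq_integral do rewrite gee0_abs ?nneseries_ge0//.
    exact: ioo.
  move=> /(integrable_ae measurableT); apply: filterS => x /(_ I).
  by rewrite ge0_fin_numE// nneseries_ge0.
(* The upper limit is defined and measurable everywhere. On the null set without convergence it only
   gives some default value. *)
pose ReL x := fine (limn_esup (fun n => (complex.Re (g n x))%:E)).
pose ImL x := fine (limn_esup (fun n => (complex.Im (g n x))%:E)).
pose v x := Complex (ReL x) (ImL x).
have mv : cmeasurable v.
  split; apply: (measurableT_comp (fine_measurable measurableT));
    apply: measurable_fun_limn_esup => n; apply/measurable_EFinP.
    exact: (mg n).1.
  exact: (mg n).2.
have cvg_fine (a : nat -> R) : cvgn a -> a @ \oo --> fine (limn_esup (EFin \o a)).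
  move=> ca; have E : EFin \o a @ \oo --> (limn a)%:E by apply: cvg_EFin => //; exact: nearW.
  by rewrite is_cvg_limn_esupE; [rewrite (cvg_lim _ E)|apply/cvg_ex; eexists; exact: E].
have aev : {ae mu, forall x, (fun n => complex.Re (g n x)) @ \oo --> ReL x /\
                             (fun n => complex.Im (g n x)) @ \oo --> ImL x}.
  apply: filterS aeH => x Hoo.
  have Hle N : \sum_(0 <= n < N) 2 ^+ n * normc (g n.+1 x - g n x) ^+ 2 <=
      fine (\sum_(n <oo) H n x)%E.
    rewrite -lee_fin fineK ?ge0_fin_numE ?nneseries_ge0// -sumEFin.
    by apply: nneseries_lim_ge => n _ _; exact: H0.
  split; apply: (cvg_fine (fun n => _ (g n x)));
    apply: cvgn_weighted_increments => N; apply: le_trans (Hle N);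
    apply: ler_sum => n _; (apply: ler_wpM2l; first exact: exprn_ge0).
  - rewrite (_ : _ - _ = complex.Re (g n.+1 x - g n x)); last first.
      by case: (g n.+1 x) (g n x) => a b [].
    rewrite -real_normK ?num_real// ler_pXn2r ?nnegrE ?normc_ge0//.
    exact: Re_le_normc.
  - rewrite (_ : _ - _ = complex.Im (g n.+1 x - g n x)); last first.
      by case: (g n.+1 x) (g n x) => a b [].
    rewrite -real_normK ?num_real// ler_pXn2r ?nnegrE ?normc_ge0//.
    exact: Im_le_normc.
have key n : (\int[mu]_x (normc (v x - g n x) ^+ 2)%:E <= (4^-1 ^+ n)%:E)%E.
  (* The shift by [n] makes the hypothesis apply for every [k], so Fatou needs no tail argument. *)
  pose F k x := (normc (g (k + n)%N x - g n x) ^+ 2)%:E.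
  have mF k : measurable_fun setT (F k) by apply: measurable_normc_sq; exact: cmeasurableB.
  have -> : (\int[mu]_x (normc (v x - g n x) ^+ 2)%:E =
             \int[mu]_x limn_einf (F ^~ x))%E; last first.
  - apply: le_trans (fatou _ measurableT mF _) _.
      by move=> k x _; rewrite lee_fin sqr_ge0.
    apply: limn_einf_le => k.
    rewrite -L2norm_sub.
    by rewrite lee_fin gC// leq_addl.
  apply: ae_eq_integral => //.
  - by apply: measurable_normc_sq; exact: cmeasurableB.
  - rewrite /limn_einf; apply: measurableT_comp => //.
    by apply: measurable_fun_limn_esup => k; exact: measurableT_comp.
  apply: filterS aev => x [rx ix] _.
  suff H1 : F ^~ x @ \oo --> (normc (v x - g n x) ^+ 2)%:E by rewrite (cvg_limn_einf_sup H1).1.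
  have normc2 (z : R[i]) : normc z ^+ 2 = complex.Re z ^+ 2 + complex.Im z ^+ 2.
    by case: z => a b /=; rewrite sqr_sqrtr// addr_ge0 ?sqr_ge0.
  apply/fine_cvgP; split; first exact: nearW.
  rewrite (_ : fine \o _ = fun k => normc (g (k + n)%N x - g n x) ^+ 2)//.
  have ReB (z t : R[i]) : complex.Re (z - t) = complex.Re z - complex.Re t.
    by case: z t => ? ? [].
  have ImB (z t : R[i]) : complex.Im (z - t) = complex.Im z - complex.Im t.
    by case: z t => ? ? [].
  under eq_fun do rewrite /= normc2 ReB ImB.
  rewrite normc2 ReB ImB.
  have cr : (fun k => complex.Re (g (k + n)%N x) - complex.Re (g n x)) @ \oo -->
      ReL x - complex.Re (g n x).
    by apply: cvgB; [rewrite (cvg_shiftn n (fun k => complex.Re (g k x)))|exact: cvg_cst].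
  have ci : (fun k => complex.Im (g (k + n)%N x) - complex.Im (g n x)) @ \oo -->
      ImL x - complex.Im (g n x).
    by apply: cvgB; [rewrite (cvg_shiftn n (fun k => complex.Im (g k x)))|exact: cvg_cst].
  by apply: cvgD; [exact: (cvgM cr cr)|exact: (cvgM ci ci)].
have sv : square_integrable mu v.
  rewrite (_ : v = fun x => (v x - g 0%N x) + g 0%N x); last first.
    by apply/funext => x; rewrite subrK.
  apply: square_integrableD; last exact: L2P.
  apply: square_integrable_lty; first exact: cmeasurableB.
  by apply: le_lt_trans (key 0%N) _; rewrite ltry.
exists (class_of sv) => n.
rewrite -lee_fin (L2norm_sub_ae _ mv); first exact: key.
exact: class_ofE.
Qed.

End completeness.

(** * Weak compactness *)

Lemma le_geometric_eq0 (R : realType) (x K : R) :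
  (forall n, `|x| <= K * 2^-1 ^+ n) -> x = 0.
Proof.
move=> H; apply/eqP; rewrite -normr_le0.
have h1 : `|2^-1 : R| < 1 by rewrite ger0_norm ?invr_ge0// invf_lt1// ltr1n.
by apply: (cvgr_to_ge (cvg_geometric K h1)); exact: nearW.
Qed.

(** Compactness of [[-M, M]] gives a cluster point, and an ultrafilter converges to each of its
    cluster points because it contains every set or its complement. *)
Lemma ultra_bounded_cvg (R : realType) (T : Type) (U : set_system T) (x : T -> R) (M : R) :
  UltraFilter U -> (forall n, `|x n| <= M) -> exists l : R, x @ U --> l.
Proof.
move=> UU xM.
have : (x @ U) `[- M, M]%classic.
  by apply: (@filterE _ U _ (x @^-1` `[- M, M]%classic)) => n /=; rewrite in_itv/= -ler_norml.
move=> /(segment_compact (fmap_proper_filter x _)) [l [_ cl]].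
exists l => V Vl /=.
have [//|nV] := @in_ultra_setVsetC _ U (x @^-1` V) UU.
by have [y [/= ny Vy]] := cl (~` V) V nV Vl.
Qed.

Section weak_compactness.
Context dT (T : measurableType dT) (R : realType).
Variable mu : {measure set T -> \bar R}.
Local Notation L2 := (L2 mu).
Implicit Types (f g h : L2).

(* Minimising [J g = |g|^2 - 2 L g]: by the parallelogram identity
   [|g - h|^2 = 2 J g + 2 J h - 4 J ((g + h) / 2)], minimising sequences are Cauchy. *)
Lemma L2_riesz (L : L2 -> R) (M : R) :
  {morph L : f g / f + g} -> (forall (a : R) f, L (a%:C%C *: f) = a * L f) ->
  (forall f, `|L f| <= M * L2norm f) ->
  exists f, forall h, L h = rinner f h.
Proof.
move=> LD LZ LM.
pose J g := rinner g g - 2 * L g.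
have J_lb : has_lbound (range J).
  exists (- M ^+ 2) => _ [g _ <-]; rewrite /J rinner_norm.
  have := LM g; rewrite ler_norml => /andP[_].
  by have := sqr_ge0 (L2norm g - M); nra.
have hJ : has_inf (range J) by split => //; exists (J 0), 0.
pose I := inf (range J).
have IJ g : I <= J g by apply: ge_inf => //; exists g.
have d0 n : 0 < 4^-1 * 4^-1 ^+ n :> R by rewrite mulr_gt0 ?exprn_gt0 ?invr_gt0.
(* The factor [4^-1] absorbs the coefficients of the parallelogram identity: the squared distance is
   at most [(4^-m + 4^-n) / 2 <= 4^-n], as [L2_complete] requires. *)
have /choice[g gP] : forall n, exists g, J g < I + 4^-1 * 4^-1 ^+ n.
  by move=> n; have [_ [g _ <-] ?] := inf_adherent (d0 n) hJ; exists g.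
have JD x y (t : R) : J (x + t%:C%C *: y) = J x + t * (2 * (rinner x y - L y)) + t ^+ 2 * rinner y y.
  by rewrite /J rinnerDl !rinnerDr !rinnerZl !rinnerZr (rinnerC y x) LD LZ; ring.
have LN x : L (- x) = - L x.
  by rewrite -scaleN1r -real_complexN1 LZ mulN1r.
have par x y : rinner (x - y) (x - y) = 2 * J x + 2 * J y - 4 * J (x + 2^-1%:C%C *: (y - x)).
  rewrite JD /J LD LN !(rinnerDl, rinnerDr, rinnerNl, rinnerNr) (rinnerC y x).
  by field.
have gC n m : (n <= m)%N -> L2norm (g m - g n) ^+ 2 <= 4^-1 ^+ n.
  move=> nm; rewrite -rinner_norm par.
  have := IJ (g m + 2^-1%:C%C *: (g n - g m)).
  have := gP n; have := gP m.
  have : 4^-1 ^+ m <= 4^-1 ^+ n :> R by rewrite ler_wiXn2l// invf_le1// ler1n.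
  lra.
have [f fP] := L2_complete gC; exists f => h.
apply/eqP; rewrite -subr_eq0; apply/eqP.
apply: (@le_geometric_eq0 _ _ (2 * L2norm h)) => n.
have e : 4^-1 ^+ n = (2^-1 ^+ n) ^+ 2 :> R.
  by rewrite exprAC; congr (_ ^+ _); field.
have p0 : 0 <= 2^-1 ^+ n :> R by rewrite exprn_ge0.
have fg : L2norm (f - g n) <= 2^-1 ^+ n.
  by rewrite -(@ler_pXn2r _ 2)// ?nnegrE ?L2norm_ge0// -e fP.
(* Moving from [g n] along [h] lowers [J] by at most [4^-n]. The resulting nonnegative quadratic in
   [t] bounds its linear coefficient, so that [J] need not be evaluated at the limit [f]. *)
have b : `|rinner (g n) h - L h| <= 2^-1 ^+ n * L2norm h.
  rewrite -(@ler_pXn2r _ 2)// ?nnegrE ?mulr_ge0 ?L2norm_ge0//.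
  rewrite real_normK ?num_real// exprMn -e -rinner_norm; apply: quadratic_ge0_discr.
    exact: rinner_ge0.
  move=> t; have := IJ (g n + t%:C%C *: h); rewrite JD => H.
  have := gP n; have : 0 <= 4^-1 ^+ n :> R by rewrite exprn_ge0.
  move: H; set A := t * _; set B := _ * rinner h h; lra.
rewrite (_ : _ - _ = - (rinner (f - g n) h) - (rinner (g n) h - L h)); last first.
  by rewrite rinnerBl; ring.
apply: le_trans (ler_normB _ _) _; rewrite normrN.
have := rinner_le (f - g n) h; have := L2norm_ge0 h; nra.
Qed.

(** Along an ultrafilter all the bounded scalar sequences [<u_n, g>] converge simultaneously. Their
    limit is a bounded real-linear functional of [g], which Riesz represents. *)
Lemma ultra_weak_limit (U : set_system nat) (u : nat -> L2) (M : R) :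
  UltraFilter U -> (forall n, L2norm (u n) <= M) ->
  exists f, forall g, (fun n => rinner (u n) g) @ U --> rinner f g.
Proof.
move=> UU uM.
have bd g n : `|rinner (u n) g| <= M * L2norm g.
  by apply: le_trans (rinner_le _ _) _; rewrite ler_wpM2r// L2norm_ge0.
have /choice[L LP] : forall g, exists l : R, (fun n => rinner (u n) g) @ U --> l.
  by move=> g; apply: ultra_bounded_cvg (bd g).
have uniq (x : nat -> R) (a b : R) : x @ U --> a -> x @ U --> b -> a = b.
  by move=> xa xb; apply: cvg_unique xa xb; exact: Rhausdorff.
have [||g|f fP] := @L2_riesz L M.
- move=> g h; apply: (uniq _ _ _ (LP (g + h))).
  by under eq_fun do rewrite rinnerDr; exact: cvgD.
- move=> a g; apply: (uniq _ _ _ (LP _)).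
  by under eq_fun do rewrite rinnerZr; apply: cvgM => //; exact: cvg_cst.
- rewrite ler_norml; apply/andP; split.
    apply: (cvgr_to_ge (LP g)); apply: nearW => n.
    by have := bd g n; rewrite ler_norml => /andP[].
  apply: (cvgr_to_le (LP g)); apply: nearW => n.
  by have := bd g n; rewrite ler_norml => /andP[].
by exists f => g; rewrite -fP; exact: LP.
Qed.

(* A subsequence along which [<u_n, u_m>] converges for every [m] converges weakly:
   two weak limits along ultrafilters have a difference that is orthogonal to all
   the [u_m], hence to both limits. *)
Lemma L2_weakly_compact (u : nat -> L2) (M : R) : (forall n, L2norm (u n) <= M) ->
  exists (s : nat -> nat) (f : L2), {homo s : m n / (m < n)%N} /\
    forall g, (fun n => rinner (u (s n)) g) @ \oo --> rinner f g.
Proof.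
move=> uM.
have [U [UU Uoo]] := ultraFilterLemma eventually_filter.
have [f fP] := ultra_weak_limit UU uM.
(* In [(j, N)], [j] is both the number of vectors [u_m] tested and the precision, and [N] is a lower
   bound for the index. Finitely many conditions hold on a common set of [U], and such a set
   contains arbitrarily large indices. *)
have /choice[pick pickP] : forall jN : nat * nat, exists n, (jN.2 <= n)%N /\
    forall m : 'I_jN.1, `|rinner f (u m) - rinner (u n) (u m)| < jN.1.+1%:R^-1.
  move=> [j N] /=; apply: (@filter_ex _ U).
  apply: filterI; first by apply: Uoo; exact: nbhs_infty_ge.
  apply: filter_forall => m; have /cvgrPdist_lt := fP (u m).
  by apply; rewrite invr_gt0.
pose s := fix s n := if n is n'.+1 then pick (n, (s n').+1) else pick (0, 0)%N.
have sinc : {homo s : m n / (m < n)%N}.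
  apply: homo_ltn; first exact: ltn_trans.
  by move=> n /=; exact: (pickP (n.+1, (s n).+1)).1.
have sP n (m : 'I_n) : `|rinner f (u m) - rinner (u (s n)) (u m)| < n.+1%:R^-1.
  by case: n m => [[]//|n] m; exact: (pickP (n.+1, (s n).+1)).2.
have scvg m : (fun n => rinner (u (s n)) (u m)) @ \oo --> rinner f (u m).
  apply/cvgrPdist_lt => e e0; near=> n.
  have mn : (m < n)%N by near: n; exact: nbhs_infty_gt.
  apply: lt_trans (sP n (Ordinal mn)) _.
  by near: n; exact: near_infty_natSinv_lt (PosNum e0).
exists s, f; split => // g; apply: contrapT => ncvg.
have [e e0 He] : exists2 e, 0 < e &
    ~ \forall n \near \oo, `|rinner f g - rinner (u (s n)) g| < e.
  apply: contrapT => H; apply: ncvg; apply/cvgrPdist_lt => e e0.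
  by apply: contrapT => H'; apply: H; exists e.
(* The indices at which convergence against [g] fails by [e]. Every cofinite set meets [B], so some
   ultrafilter [V] finer than the cofinite filter contains [B]; showing that the weak limit along
   [V] is again [f] gives the contradiction. *)
pose B := [set n | ~ `|rinner f g - rinner (u (s n)) g| < e].
have PB : ProperFilter (within B \oo).
  apply: Build_ProperFilter; rewrite /within /= => H; apply: He.
  apply: filterS H => n nB.
  by apply: contrapT => nlt; exact: (nB nlt).
have [V [VU VB]] := ultraFilterLemma PB.
have Voo : \oo `<=` V by move=> A A0; apply: VB; rewrite /within /=; apply: filterS A0.
have [f' f'P] := ultra_weak_limit VU (fun n => uM (s n)).
have uniq (W : set_system nat) (x : nat -> R) (a b : R) :
    ProperFilter W -> x @ W --> a -> x @ W --> b -> a = b.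
  by move=> WP xa xb; apply: cvg_unique xa xb; exact: Rhausdorff.
have VS (x : nat -> R) (l : R) : x @ \oo --> l -> x @ V --> l.
  by move=> xl A /xl; exact: Voo.
have Eu m : rinner (u m) (f - f') = 0.
  rewrite rinnerC rinnerBl; apply/eqP; rewrite subr_eq0; apply/eqP.
  exact: (uniq V _ _ _ (@ultra_proper _ V VU) (VS _ _ (scvg m)) (f'P (u m))).
have E : f = f'.
  apply/eqP; rewrite -subr_eq0; apply/eqP; apply: L2norm_eq0; apply/eqP.
  rewrite -sqrf_eq0 -rinner_norm rinnerBl.
  have -> : rinner f (f - f') = 0.
    apply: (uniq U _ _ _ (@ultra_proper _ U UU) (fP (f - f'))).
    by under eq_fun do rewrite Eu; exact: cvg_cst.
  rewrite sub0r oppr_eq0; apply/eqP.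
  apply: (uniq V _ _ _ (@ultra_proper _ V VU) (f'P (f - f'))).
  by under eq_fun do rewrite Eu; exact: cvg_cst.
have VBB : V B by apply: VB; exact: withinT.
have VnB : V (~` B).
  have /cvgrPdist_lt/(_ e e0) := f'P g; rewrite -E.
  by apply: filterS => n; rewrite /B /= => H; exact.
by have [n []] := @filter_ex _ V _ _ (filterI VBB VnB).
Unshelve. all: by end_near. Qed.

End weak_compactness.

(** * Compact positive forms *)

Lemma cvg_maxr (R : realType) (T : Type) (F : set_system T) (a b : T -> R) (l m : R) :
  Filter F -> a @ F --> l -> b @ F --> m ->
  (fun x => Num.max (a x) (b x)) @ F --> Num.max l m.
Proof.
move=> FF al bm; apply/cvgrPdist_lt => e e0.
have /cvgrPdist_lt/(_ e e0) al' := al; have /cvgrPdist_lt/(_ e e0) := bm.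
apply: filterS2 al' => x; rewrite !ltr_norml => /andP[? ?] /andP[? ?].
by case: (leP l m); case: (leP (a x) (b x)) => ? ?; apply/andP; split; lra.
Qed.

Section positive_compact.
Context dT (T : measurableType dT) (R : realType).
Variable mu : {measure set T -> \bar R}.
Local Notation L2 := (L2 mu).
Implicit Types (f g h : L2).
Variable A : {linear L2 -> L2}.
Hypothesis A_pos : positive_operator A.

Lemma rinner_i f g : rinner ('i%C *: f) ('i%C *: g) = rinner f g.
Proof. by rewrite -Im_inner innerZl /rinner; case: (inner f g) => a b /=; ring. Qed.

Lemma positive_inner f : inner (A f) f = ((rinner (A f) f)%:C)%C.
Proof.
have := ger0_Im (A_pos f); rewrite /rinner.
by case: (inner (A f) f) => a b /= ->.
Qed.

Lemma positive_ge0 f : 0 <= rinner (A f) f.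
Proof. by have := A_pos f; rewrite positive_inner ler0c. Qed.

(** Polarization: [<A h, h>] is real for [h = x + y], which makes the mixed terms cancel in the
    imaginary part ([D]). Replacing [x] by [i f] turns this into symmetry of the real part. *)
Lemma positive_sym f g : rinner (A f) g = rinner f (A g).
Proof.
have Z h : rinner (A h) ('i%C *: h) = 0 by rewrite -Im_inner positive_inner.
have D x y : rinner (A x) ('i%C *: y) + rinner (A y) ('i%C *: x) = 0.
  have := Z (x + y).
  by rewrite linearD scalerDr rinnerDl !rinnerDr !Z add0r addr0 addrC.
have := D ('i%C *: f) g.
rewrite linearZ /= rinner_i scalerA -expr2 sqr_i scaleN1r rinnerNr.
by move/eqP; rewrite subr_eq0 => /eqP ->; rewrite rinnerC.
Qed.

Definition quad h := rinner (A h) h.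

Lemma quadB h g : quad (h - g) = quad h - (2 * rinner h (A g) - quad g).
Proof.
rewrite /quad linearB rinnerBl !rinnerBr (rinnerC (A g) h) -(positive_sym h g); ring.
Qed.

(* [quad h - quad (h - g)] is affine and weakly continuous in [h]; it lies below
   [quad h], and the gap is small when [A g] is close to [A h]. *)
Definition max_minorant (s : seq L2) h :=
  \big[Num.max/0]_(g <- s) (2 * rinner h (A g) - quad g).

Hypothesis A_compact : compact_operator A.

(** Without a finite net, points of the ball could be added greedily so that their images stay [e]
    apart, and no subsequence of the images would converge. *)
Lemma compact_net (M e : R) : 0 < e -> exists s : seq L2,
  (forall g, g \in s -> L2norm g <= M) /\
  forall h, L2norm h <= M -> exists2 g, g \in s & L2norm (A h - A g) < e.
Proof.
move=> e0; apply: contrapT => nH.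
(* The ball condition on [s] is placed under the existential so that [F] is total on lists; [sM]
   discharges it along the construction. *)
have /choice[F FP] : forall s : seq L2, exists h, (forall g, g \in s -> L2norm g <= M) ->
    L2norm h <= M /\ forall g, g \in s -> e <= L2norm (A h - A g).
  move=> s; apply: contrapT => nh; apply: nH; exists s; split.
    move=> g gs; apply: contrapT => gM; apply: nh; exists 0 => sM.
    by case: gM; exact: sM.
  move=> h hM; apply: contrapT => ng; apply: nh; exists h => _; split => // g gs.
  by rewrite leNgt; apply/negP => lt; apply: ng; exists g.
pose s := fix s n := if n is n'.+1 then F (s n') :: s n' else [::].
have sM n g : g \in s n -> L2norm g <= M.
  elim: n g => [//|n IH] g /=; rewrite inE => /orP[/eqP ->|]; last exact: IH.
  exact: (FP (s n) IH).1.
have mem m n : (m < n)%N -> F (s m) \in s n.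
  elim: n => [//|n IH]; rewrite ltnS leq_eqVlt => /orP[/eqP ->|/IH] /=.
    by rewrite inE eqxx.
  by rewrite inE orbC => ->.
have sep m n : (m < n)%N -> e <= L2norm (A (F (s n)) - A (F (s m))).
  by move=> mn; apply: (FP (s n) (sM n)).2; exact: mem.
have bdF : exists M0 : R, forall n, L2norm (F (s n)) <= M0.
  by exists M => n; exact: (FP (s n) (sM n)).1.
have [t [g [tinc /cvgrPdist_lt/(_ (e / 2))]]] := A_compact bdF.
rewrite divr_gt0// => /(_ isT) [N _ H].
have := sep _ _ (tinc N N.+1 (leqnn _)).
have := H N (leqnn _); have := H N.+1 (leqnSn _).
rewrite /= !sub0r !normrN !ger0_norm ?L2norm_ge0//.
have -> : A (F (s (t N.+1))) - A (F (s (t N))) =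
  (A (F (s (t N.+1))) - g) + - (A (F (s (t N))) - g).
  by rewrite opprB addrA subrK.
have := L2normD (A (F (s (t N.+1))) - g) (- (A (F (s (t N))) - g)).
rewrite L2normN; lra.
Qed.

(** Each term falls short of [quad h] by [quad (h - g)], and the initial value [0] by [quad h]; both
    are nonnegative. *)
Lemma max_minorant_le s h : 0 <= max_minorant s h <= quad h.
Proof.
have pos := positive_ge0; rewrite /max_minorant; elim: s => [|g s /andP[IH1 IH2]].
  by rewrite big_nil lexx pos.
rewrite big_cons le_max IH1 orbT/= ge_max IH2 andbT.
by rewrite -subr_ge0 -quadB pos.
Qed.

Lemma le_max_minorant s g h : g \in s -> 2 * rinner h (A g) - quad g <= max_minorant s h.
Proof.
rewrite /max_minorant; elim: s => [//|k s IH]; rewrite inE big_cons le_max.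
by move=> /orP[/eqP ->|/IH ->]; rewrite ?lexx ?orbT.
Qed.

(** If [g] in the net has [|A h - A g|] small, its tangent misses [quad h] by [<A (h - g), h - g>],
    at most [|A h - A g|] times the diameter of the ball. The [+ 1] in [2 * M + 1] keeps the divisor
    positive when [M = 0]. *)
Lemma quad_approx (M e : R) : 0 < e -> exists s, forall h, L2norm h <= M ->
  quad h <= max_minorant s h + e.
Proof.
move=> e0; have [M0|M0] := ltP M 0.
  by exists [::] => h /le_lt_trans/(_ M0); rewrite ltNge L2norm_ge0.
have d0 : 0 < 2 * M + 1 by lra.
have [s [sM sP]] := compact_net M (divr_gt0 e0 d0).
exists s => h hM; have [g gs hg] := sP h hM.
have := le_max_minorant h gs.
have : quad (h - g) <= e.
  apply: le_trans (ler_norm _) _; apply: le_trans (rinner_le _ _) _.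
  rewrite linearB.
  have hgM : L2norm (h - g) <= 2 * M + 1.
    have := L2normD h (- g); rewrite L2normN; have := sM _ gs; lra.
  apply: le_trans (_ : e / (2 * M + 1) * (2 * M + 1) <= _).
    by apply: ler_pM; rewrite ?L2norm_ge0// ltW.
  by rewrite divfK// gt_eqF.
rewrite quadB; lra.
Qed.

(** On the ball, [quad] exceeds a finite maximum of affine functionals by at most [1], and
    Cauchy-Schwarz bounds each of them. *)
Lemma quad_bounded (M : R) : exists C, forall h, L2norm h <= M -> quad h <= C.
Proof.
have [s sP] := quad_approx M ltr01.
suff [C CP] : exists C, forall h, L2norm h <= M -> max_minorant s h <= C.
  by exists (C + 1) => h hM; have := sP h hM; have := CP h hM; lra.
rewrite /max_minorant; elim: (s) => [|g {}s' [C CP]].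
  by exists 0 => h _; rewrite big_nil.
exists (Num.max (2 * (M * L2norm (A g))) C) => h hM; rewrite big_cons.
rewrite ge_max !le_max CP// orbT andbT; apply/orP; left.
have := rinner_le h (A g); rewrite ler_norml => /andP[_].
have := positive_ge0 g; rewrite -/(quad g); have := L2norm_ge0 (A g); nra.
Qed.

Lemma quad_weak_cvg (w_ : nat -> L2) (w : L2) (M : R) :
  (forall n, L2norm (w_ n) <= M) -> L2norm w <= M ->
  (forall g, (fun n => rinner (w_ n) g) @ \oo --> rinner w g) ->
  (fun n => quad (w_ n)) @ \oo --> quad w.
Proof.
move=> w_M wM w_w; apply/cvgrPdist_lt => e e0.
have e3 : 0 < e / 3 by rewrite divr_gt0.
have [s sP] := quad_approx M e3.
have : (fun n => max_minorant s (w_ n)) @ \oo --> max_minorant s w.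
  rewrite /max_minorant; elim: (s) => [|g s' IH].
    by rewrite big_nil; under eq_fun do rewrite big_nil; exact: cvg_cst.
  rewrite big_cons; under eq_fun do rewrite big_cons.
  apply: cvg_maxr => //; apply: cvgB; last exact: cvg_cst.
  by apply: cvgM; [exact: cvg_cst|exact: w_w].
move=> /cvgrPdist_lt/(_ _ e3); apply: filterS => n.
have /andP[_ a1] := max_minorant_le s (w_ n); have a2 := sP _ (w_M n).
have /andP[_ a3] := max_minorant_le s w; have a4 := sP _ wM.
rewrite !ltr_norml => /andP[b1 b2]; apply/andP; split; lra.
Qed.

(** The bound [M] is uniform in [z], so one list per precision serves all [z]. Thus [quad (w z)] is
    a pointwise limit of finite maxima of measurable functions, and no sigma-algebra on [L2] is
    needed. *)
Lemma quad_measurable dZ (Z : measurableType dZ) (w : Z -> L2) (M : R) :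
  (forall z, L2norm (w z) <= M) ->
  (forall g, measurable_fun setT (fun z => rinner (w z) g)) ->
  measurable_fun setT (fun z => quad (w z)).
Proof.
move=> wM mw.
have /choice[s sP] : forall n, exists s, forall h, L2norm h <= M ->
    quad h <= max_minorant s h + n.+1%:R^-1.
  by move=> n; apply: quad_approx; rewrite invr_gt0.
apply: (@measurable_fun_cvg _ _ _ _ (fun n z => max_minorant (s n) (w z))).
  move=> n; rewrite /max_minorant; elim: (s n) => [|g s' IH].
    by under eq_fun do rewrite big_nil; exact: measurable_cst.
  under eq_fun do rewrite big_cons.
  apply: measurable_maxr => //; apply: measurable_funB => //.
  by apply: measurable_funM.
move=> z _; apply/cvgrPdist_lt => e e0; near=> n.
have a2 := sP n _ (wM z); have /andP[_ a1] := max_minorant_le (s n) (w z).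
rewrite ger0_norm ?subr_ge0//; apply: le_lt_trans (_ : n.+1%:R^-1 < _); first by rewrite lerBlDl.
by near: n; exact: near_infty_natSinv_lt (PosNum e0).
Unshelve. all: by end_near. Qed.

End positive_compact.

(** * Dominated convergence of Lp norms *)

Lemma powR_cvg (R : realType) (x_ : nat -> R) (x a : R) : 0 < a ->
  (forall n, 0 <= x_ n) -> 0 <= x -> x_ @ \oo --> x ->
  (fun n => x_ n `^ a) @ \oo --> x `^ a.
Proof.
move=> a0 x_0; rewrite le_eqVlt => /orP[/eqP <-|x0] x_x.
  rewrite powR0 ?gt_eqF//; apply/cvgrPdist_lt => e e0.
  have e1 : 0 < e `^ a^-1 by rewrite powR_gt0.
  move/cvgrPdist_lt/(_ _ e1) : x_x; apply: filterS => n.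
  rewrite !sub0r !normrN !ger0_norm ?powR_ge0// => H.
  have -> : e = (e `^ a^-1) `^ a by rewrite -powRrM mulVf ?gt_eqF// powRr1// ltW.
  by rewrite gt0_ltr_powR// nnegrE ?powR_ge0.
have x_gt : \forall n \near \oo, 0 < x_ n by exact: (cvgr_gt x).
apply: cvg_trans (_ : (fun n => expR (a * ln (x_ n))) @ \oo --> _).
  by apply: near_eq_cvg; apply: filterS x_gt => n n0; rewrite /powR gt_eqF.
rewrite /powR gt_eqF//; apply: continuous_cvg; first exact: continuous_expR.
apply: cvgM; first exact: cvg_cst.
by apply: continuous_cvg => //; exact: continuous_ln.
Qed.

Lemma poweR_cvg (R : realType) (x_ : nat -> \bar R) (x : \bar R) (a : R) : 0 < a ->
  (forall n, 0 <= x_ n)%E -> (0 <= x)%E -> (x < +oo)%E -> x_ @ \oo --> x ->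
  (fun n => x_ n `^ a)%E @ \oo --> (x `^ a)%E.
Proof.
move=> a0 x_0 x0 xoo x_x; have xf : x \is a fin_num by rewrite ge0_fin_numE.
move: x_x; rewrite -(fineK xf) => /fine_cvgP [x_f x_x].
rewrite poweR_EFin; apply/fine_cvgP; split.
  by apply: filterS x_f => n /fineK <-; rewrite poweR_EFin.
apply: cvg_trans (_ : (fun n => fine (x_ n) `^ a) @ \oo --> _).
  by apply: near_eq_cvg; apply: filterS x_f => n /fineK xn /=; rewrite -[in RHS]xn poweR_EFin.
by apply: powR_cvg => //; [move=> n|]; exact: fine_ge0.
Qed.

Section Lp.
Context d (T : measurableType d) (R : realType).
Variables (mu : {measure set T -> \bar R}) (D : set T) (p : R).
Hypotheses (mD : measurable D) (Doo : (mu D < +oo)%E) (p0 : 0 < p).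
Implicit Types phi psi : T -> R.

Local Notation N phi := ('N[mu]_(p%:E)[(fun z => (phi z)%:E) \_ D])%E.

Lemma Lnorm_patchE phi : (forall z, 0 <= phi z) ->
  N phi = ((\int[mu]_(z in D) (phi z `^ p)%:E) `^ p^-1)%E.
Proof.
move=> phi0; rewrite unlock /= [in RHS]integral_mkcond; congr (_ `^ _)%E.
apply: eq_integral => z _; rewrite !patchE; case: ifP => _.
  by rewrite /= ger0_norm.
by rewrite /= normr0 powR0// gt_eqF.
Qed.

Lemma measurable_powR_EFin phi : measurable_fun setT phi ->
  measurable_fun D (fun z => (phi z `^ p)%:E).
Proof.
move=> mphi; apply/measurable_EFinP; apply: measurable_funTS.
exact: (measurableT_comp (measurable_powR p)).
Qed.

Lemma le_Lnorm_patch phi psi : measurable_fun setT phi -> measurable_fun setT psi ->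
  (forall z, 0 <= phi z <= psi z) -> (N phi <= N psi)%E.
Proof.
move=> mphi mpsi le.
have phi0 z : 0 <= phi z by case/andP: (le z).
have psi0 z : 0 <= psi z by case/andP: (le z); exact: le_trans.
rewrite !Lnorm_patchE//; apply: gt0_ler_poweR; first by rewrite invr_ge0 ltW.
- by rewrite in_itv/= leey integral_ge0// => z _; rewrite lee_fin powR_ge0.
- by rewrite in_itv/= leey integral_ge0// => z _; rewrite lee_fin powR_ge0.
apply: ge0_le_integral => //.
- by move=> z _; rewrite lee_fin powR_ge0.
- exact: measurable_powR_EFin.
- exact: measurable_powR_EFin.
- move=> z _; rewrite lee_fin ge0_ler_powR ?nnegrE//; first exact: ltW.
  by case/andP: (le z).
Qed.

Lemma Lnorm_patchZ (a : R) phi : 0 <= a -> measurable_fun setT phi ->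
  (forall z, 0 <= phi z) -> (N (fun z => a * phi z)%R = a%:E * N phi)%E.
Proof.
move=> a0 mphi phi0; rewrite !Lnorm_patchE//; last by move=> z; rewrite mulr_ge0.
under eq_integral do rewrite powRM// EFinM.
rewrite ge0_integralZl//.
- rewrite poweRM.
  + by rewrite poweR_EFin -powRrM divff ?gt_eqF// powRr1.
  + by rewrite lee_fin powR_ge0.
  + by apply: integral_ge0 => z _; rewrite lee_fin powR_ge0.
- exact: measurable_powR_EFin.
- by move=> z _; rewrite lee_fin powR_ge0.
- by rewrite lee_fin powR_ge0.
Qed.

Lemma Lnorm_patch_cvg (phi_ : nat -> T -> R) phi (C : R) :
  (forall n, measurable_fun setT (phi_ n)) -> measurable_fun setT phi ->
  (forall n z, 0 <= phi_ n z <= C) ->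
  (forall z, (fun n => phi_ n z) @ \oo --> phi z) ->
  (fun n => N (phi_ n)) @ \oo --> N phi /\ (N phi < +oo)%E.
Proof.
move=> mphi_ mphi bd phi_phi.
have phi_0 n z : 0 <= phi_ n z by case/andP: (bd n z).
have phi0 z : 0 <= phi z.
  by apply: (cvgr_to_ge (phi_phi z)); exact: nearW.
have iC : mu.-integrable D (cst (C `^ p)%:E).
  apply/integrableP; split; first exact: measurable_cst.
  rewrite integral_cst// lte_mul_pinfty//.
have [||||ip _ ic] := @dominated_convergence _ T R mu D mD
    (fun n z => (phi_ n z `^ p)%:E) (fun z => (phi z `^ p)%:E) (cst (C `^ p)%:E) _ _ _ iC.
- by move=> n; exact: measurable_powR_EFin.
- exact: measurable_powR_EFin.
- apply: nearW => z _; apply/fine_cvgP; split; first exact: nearW.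
  exact: powR_cvg.
- apply: nearW => z n _; rewrite /= ger0_norm ?powR_ge0// lee_fin.
  have /andP[a b] := bd n z; apply: ge0_ler_powR; rewrite ?nnegrE//; first exact: ltW.
  exact: le_trans b.
have i0 : (0 <= \int[mu]_(z in D) (phi z `^ p)%:E)%E.
  by apply: integral_ge0 => z _; rewrite lee_fin powR_ge0.
have ioo : (\int[mu]_(z in D) (phi z `^ p)%:E < +oo)%E by exact: integrable_lty.
rewrite Lnorm_patchE//; under eq_fun do rewrite Lnorm_patchE//.
split; last exact: poweR_lty.
apply: poweR_cvg => //; first by rewrite invr_gt0.
by move=> n; apply: integral_ge0 => z _; rewrite lee_fin powR_ge0.
Qed.

End Lp.

(** * Time-frequency shifts *)

(** Tonelli applies to the positive and negative parts separately. The sections need not be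
    integrable: where they are not, [fine] supplies a value measurably. *)
Lemma measurable_fun_Rintegral d1 d2 (T1 : measurableType d1) (T2 : measurableType d2)
    (R : realType) (m2 : {sigma_finite_measure set T2 -> \bar R}) (k : T1 * T2 -> R) :
  measurable_fun setT k ->
  measurable_fun setT (fun x => Rintegral m2 setT (fun y => k (x, y))).
Proof.
move=> mk; apply: (measurableT_comp (fine_measurable measurableT)).
have mk' : measurable_fun setT (EFin \o k) by exact/measurable_EFinP.
rewrite (_ : (fun x => _) = (fun x => fubini_F m2 (EFin \o k)^\+ x - fubini_F m2 (EFin \o k)^\- x)%E).
  apply: emeasurable_funB; apply: measurable_fun_fubini_tonelli_F.
  - exact: measurable_funepos.
  - by move=> x; exact: funepos_ge0.
  - exact: measurable_funeneg.
  - by move=> x; exact: funeneg_ge0.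
apply/funext => x; rewrite integralE /fubini_F.
by congr (_ - _)%E; apply: eq_integral => y _; rewrite ?funeposE ?funenegE.
Qed.

Section time_frequency.
Context (R : realType) (d : nat).
Local Notation E := (d.-tuple R).
Local Notation lambda := (lebesgue_tuple R d).
Local Notation L2R := (L2 lambda).
Implicit Types (f g h : L2R) (z : E * E).

Lemma pi_opE z f : (pi_op z f : E -> R[i]) = tf_shift z f %[ae lambda].
Proof. exact: class_ofE. Qed.

Lemma expi_conj (t : R) : expi t * (expi t)^*%C = 1.
Proof.
rewrite /expi /=; congr Complex; last by ring.
by rewrite -[RHS](cos2Dsin2 t); ring.
Qed.

Lemma conjcM (a b : R[i]) : ((a * b)^*)%C = (a^*)%C * (b^*)%C.
Proof. exact: (rmorphM (@conjc R)). Qed.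

Lemma inner_pi_op z f g : inner (pi_op z f) (pi_op z g) = inner f g.
Proof.
have [mf _] := L2P f; have [mg _] := L2P g.
have mfg : cmeasurable (fun y => f y * (g y)^*%C).
  by apply: cmeasurableM => //; exact: cmeasurableJ.
rewrite [RHS]/inner -(cintegral_translate z.1 mfg); apply: cintegral_ae.
- exact: cmeasurableM (L2P _).1 (cmeasurableJ (L2P _).1).
- exact: (cmeasurable_translate z.1 mfg).
apply: filterS2 (pi_opE z f) (pi_opE z g) => y E1 E2 _; rewrite E1// E2//.
by rewrite /tf_shift conjcM mulrACA expi_conj mul1r.
Qed.

(** The preimage is the inverse shift, [y |-> conj (expi (2 pi xi . (y + x))) f (y + x)]; [o] is
    [- x]. Surjectivity lets [L2norm_adjoint_pi] reduce to vectors [pi_op z h]. *)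
Lemma pi_op_surj z f : exists h, pi_op z h = f.
Proof.
case: z => x xi.
pose o : E := tsub [tuple 0 | _ < d] x.
have xo y : tsub (tsub y x) o = y.
  by apply: eq_from_tnth => i; rewrite !tnth_mktuple; ring.
pose u (y : E) : R[i] := ((expi (2 * pi * dotp xi (tsub y o)))^*)%C.
have mu_ : cmeasurable u.
  exact: cmeasurableJ (cmeasurable_translate o (cmeasurable_expi xi (2 * pi))).
have u1 y : normc (u y) = 1 by rewrite normc_conj normc_expi.
have H := square_integrable_mod o mu_ u1 (L2P f).
exists (class_of H); apply: L2_ext.
apply: filterS2 (pi_opE (x, xi) (class_of H)) (ae_translate x (class_ofE H)) => y E1 E2 _.
by rewrite E1// /tf_shift E2// /u !xo mulrA expi_conj mul1r.
Qed.

(** [adjoint] is given by choice, so only its defining identity is available. Testing the difference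
    [k] against itself gives [0], since [pi_op z] preserves inner products; [adjoint_piZ] argues in
    the same way. *)
Lemma adjoint_pi_op z h : adjoint (pi_op z) (pi_op z h) = h.
Proof.
apply/eqP; rewrite -subr_eq0; apply/eqP; apply: L2norm_eq0; apply/eqP.
rewrite -sqrf_eq0 -rinner_norm; set k := adjoint _ _ - h.
by rewrite {2}/k rinnerBr {1}/rinner -inner_adjoint_pi inner_pi_op subrr.
Qed.

Lemma L2norm_adjoint_pi z f : L2norm (adjoint (pi_op z) f) = L2norm f.
Proof.
have [h <-] := pi_op_surj z f; rewrite adjoint_pi_op.
apply/eqP; rewrite -(@eqrXn2 _ 2)// ?L2norm_ge0// -!rinner_norm.
by rewrite /rinner inner_pi_op.
Qed.

Lemma rinner_adjoint_pi z f g :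
  rinner (adjoint (pi_op z) f) g = rinner (pi_op z g) f.
Proof. by rewrite rinnerC /rinner -inner_adjoint_pi. Qed.

Lemma adjoint_piZ z (a : R) f :
  adjoint (pi_op z) (a%:C%C *: f) = a%:C%C *: adjoint (pi_op z) f.
Proof.
apply/eqP; rewrite -subr_eq0; apply/eqP; apply: L2norm_eq0; apply/eqP.
rewrite -sqrf_eq0 -rinner_norm; set k := _ - _.
by rewrite {1}/k rinnerBl rinner_adjoint_pi rinnerZr rinnerZl rinner_adjoint_pi subrr.
Qed.

Lemma measurable_adjoint_pi f g :
  measurable_fun setT (fun z : E * E => rinner (adjoint (pi_op z) f) g).
Proof.
(* The kernel uses the formula [tf_shift], which is jointly measurable in [(z, y)]. The
   representatives of [pi_op z g] are chosen separately for each [z] and need not be. *)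
pose k (q : (E * E) * E) := tf_shift q.1 g q.2 * (f q.2)^*%C.
have [[mf1 mf2] _] := L2P f; have [[mg1 mg2] _] := L2P g.
have m2 : measurable_fun setT (fun q : (E * E) * E => q.2) by exact: measurable_snd.
have m11 : measurable_fun setT (fun q : (E * E) * E => q.1.1).
  exact: (measurableT_comp measurable_fst measurable_fst).
have m12 : measurable_fun setT (fun q : (E * E) * E => q.1.2).
  exact: (measurableT_comp measurable_snd measurable_fst).
have mt : measurable_fun setT (fun q : (E * E) * E => tsub q.2 q.1.1).
  apply/measurable_fun_tnthP => i.
  rewrite (_ : _ \o _ = fun q : (E * E) * E => tnth q.2 i - tnth q.1.1 i); last first.
    by apply/funext => q /=; rewrite tnth_mktuple.
  by apply: measurable_funB; [exact: (measurableT_comp (measurable_tnth i) m2)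
    |exact: (measurableT_comp (measurable_tnth i) m11)].
have md : measurable_fun setT (fun q : (E * E) * E => 2 * pi * dotp q.1.2 q.2).
  apply: measurable_funM => //; apply: measurable_sum => i.
  by apply: measurable_funM; [exact: (measurableT_comp (measurable_tnth i) m12)
    |exact: (measurableT_comp (measurable_tnth i) m2)].
have mk : cmeasurable k.
  apply: cmeasurableM; first apply: cmeasurableM.
  - split; [apply: (@measurableT_comp _ _ _ _ _ _ (@cos R)) md
      |apply: (@measurableT_comp _ _ _ _ _ _ (@sin R)) md];
      apply: continuous_measurable_fun; [exact: continuous_cos|exact: continuous_sin].
  - by split; [apply: (measurableT_comp mg1)|apply: (measurableT_comp mg2)].
  - apply: cmeasurableJ.
    by split; [apply: (measurableT_comp mf1)|apply: (measurableT_comp mf2)].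
rewrite (_ : (fun z => _) =
    (fun z => Rintegral lambda setT (fun y => complex.Re (k (z, y))))).
  by apply: (@measurable_fun_Rintegral _ _ _ _ _ _ (fun q => complex.Re (k q))); exact: mk.1.
apply/funext => z; rewrite rinner_adjoint_pi /rinner /inner.
rewrite (@cintegral_ae _ _ _ _ _ (fun y => k (z, y)))//.
- exact: cmeasurableM (L2P _).1 (cmeasurableJ (L2P _).1).
- apply: cmeasurableM; last exact: cmeasurableJ.
  exact: (square_integrable_tf_shift z (L2P g)).1.
by apply: filterS (pi_opE z g) => y E1 _; rewrite E1.
Qed.

(** Connects measurability for the product sigma-algebra, which Fubini yields, with the larger
    sigma-algebra on which [volume] lives. *)
Lemma measurable_caratheodory (phi : E * E -> R) : measurable_fun setT phi ->
  @measurable_fun _ _ (caratheodory_type (@phase_measure R d)^*%mu) _ setT phi.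
Proof.
move=> mphi _ Y mY; have := mphi measurableT Y mY; rewrite !setTI => H.
by apply: sub_caratheodory; exact: sub_sigma_algebra.
Qed.

(** The indicator of the unit cube, built by induction on the dimension; for [d = 0] it is the whole
    one-point space. It makes the supremum range over a nonempty set and replaces a vanishing weak
    limit. *)
Lemma L2_nontrivial : exists e : L2R, L2norm e = 1.
Proof.
have [B [mB B1]] : exists B : set E, measurable B /\ lambda B = 1%E.
  elim: d => [|n [B [mB B1]]].
    by exists setT; split => //=; rewrite diracT.
  exists [set t | `[0, 1]%classic (thead t) /\ B [tuple of behead t]]; split.
    have m1 : measurable ((fun t : n.+1.-tuple R => thead t) @^-1` `[0, 1]%classic).
      by rewrite -[X in measurable X]setTI; apply: measurable_tnth.
    have m2 : measurable ((fun t : n.+1.-tuple R => [tuple of behead t]) @^-1` B).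
      by rewrite -[X in measurable X]setTI; apply: measurable_behead.
    exact: measurableI.
  rewrite /= /pushforward (_ : _ @^-1` _ = `[0, 1]%classic `*` B).
    rewrite product_measure1E//.
    rewrite B1 mule1; have := @lebesgue_measure_itv R `[0, 1].
    by rewrite /= lte_fin ltr01 oppr0 adde0.
  have bK (a : R) (t : n.-tuple R) : [tuple of behead (tcons (a, t))] = t by exact/val_inj.
  by apply/seteqP; split => -[a t] /=; rewrite bK.
have iE x : normc ((\1_B x : R)%:C)%C ^+ 2 = \1_B x :> R.
  by rewrite /= expr0n addr0 sqr_sqrtr ?sqr_ge0// indicE; case: (x \in B); rewrite ?expr1n ?expr0n.
have iB : (\int[lambda]_x (\1_B x)%:E = 1)%E by rewrite integral_indic// setIT; exact: B1.
have sB : square_integrable lambda (fun x => (\1_B x : R)%:C%C).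
  apply: square_integrable_lty.
    by split; [exact: measurable_indic|exact: measurable_cst].
  under eq_integral do rewrite iE.
  by rewrite iB ltry.
exists (class_of sB); apply/eqP; rewrite -(@eqrXn2 _ 2)// ?L2norm_ge0// expr1n.
apply/eqP; apply: EFin_inj; rewrite L2norm_sqE.
transitivity (\int[lambda]_x (\1_B x)%:E)%E.
  apply: ae_eq_integral => //.
  - exact: measurable_normc_sq (L2P _).1.
  - exact/measurable_EFinP/measurable_indic.
  by apply: filterS (class_ofE sB) => x -> // _; rewrite iE.
exact: iB.
Qed.

End time_frequency.

(** * Convergence of the norms and maximizers *)

Lemma cvg_homo_infty (s : nat -> nat) : {homo s : m n / (m < n)%N} -> s @ \oo --> \oo.
Proof.
move=> sinc; have les n : (n <= s n)%N.
  by elim: n => [//|n IH]; exact: leq_ltn_trans IH (sinc _ _ (ltnSn n)).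
by move=> A [N _ NA]; exists N => // n /= Nn; apply: NA => /=; exact: leq_trans (les n).
Qed.

Section maximizer.
Context (R : realType) (d : nat).
Local Notation E := (d.-tuple R).
Local Notation L2R := (L2 (lebesgue_tuple R d)).
Variables (S0 : {linear L2R -> L2R}) (c : R) (S : L2R -> L2R).
Variables (p : R) (Omega : set (E * E)).
Hypotheses (S0_compact : compact_operator S0) (S0_positive : positive_operator S0).
Hypotheses (c_ge0 : 0 <= c) (S_def : forall f, S f = (c%:C)%C *: f + S0 f).
Hypotheses (p_gt0 : 0 < p) (Omega_measurable : lebesgue_measurable Omega).
Hypothesis Omega_lty : (volume Omega < +oo)%E.
Implicit Types (f g h : L2R) (z : E * E).

Definition symbol f z : R := quad S0 (adjoint (pi_op z) f).

Lemma symbol_ge0 f z : 0 <= symbol f z.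
Proof. exact: (positive_ge0 S0_positive). Qed.

Lemma Q_symbol f z : Q S0 f z = ((symbol f z)%:C)%C.
Proof. by rewrite /Q /alpha /= inner_adjoint_pi positive_inner. Qed.

Lemma Q_perturbed f z : Q S f z = ((c * L2norm f ^+ 2 + symbol f z)%:C)%C.
Proof.
rewrite /Q /alpha /= inner_adjoint_pi S_def innerDl innerZl positive_inner//.
by rewrite innerE L2norm_adjoint_pi -rmorphM -rmorphD.
Qed.

Lemma symbolZ (a : R) f z : symbol (a%:C%C *: f) z = a ^+ 2 * symbol f z.
Proof. by rewrite /symbol /quad adjoint_piZ linearZ /= rinnerZl rinnerZr mulrA. Qed.

Lemma measurable_symbol f : measurable_fun setT (symbol f).
Proof.
apply: (quad_measurable S0_positive S0_compact (M := L2norm f)).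
  by move=> z; rewrite L2norm_adjoint_pi.
by move=> g; exact: measurable_adjoint_pi.
Qed.

Local Notation N phi := ('N[@volume R d]_(p%:E)[(fun z => (phi z)%:E) \_ Omega])%E.

Lemma LpNorm_real (F : E * E -> R[i]) (phi : E * E -> R) :
  (forall z, 0 <= phi z) -> (forall z, F z = ((phi z)%:C)%C) -> LpNorm Omega p F = N phi.
Proof.
move=> phi0 Fphi; rewrite /LpNorm; congr Lnorm; congr patch; apply/funext => z.
by rewrite Fphi /= expr0n addr0 sqrtr_sqr ger0_norm.
Qed.

Lemma measurable_affine_symbol (a : R) f :
  @measurable_fun _ _ (caratheodory_type (@phase_measure R d)^*%mu) _ setT
    (fun z => a + symbol f z).
Proof.
apply: measurable_caratheodory; apply: measurable_funD => //.
exact: measurable_symbol.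
Qed.

(** Testing against [f] itself: [|f|^2 = lim <f_n, f> <= |f|]. *)
Lemma weak_limit_norm_le (f_ : nat -> L2R) f : (forall n, L2norm (f_ n) = 1) ->
  (forall g, (fun n => rinner (f_ n) g) @ \oo --> rinner f g) -> L2norm f <= 1.
Proof.
move=> f_1 f_f; have : rinner f f <= L2norm f.
  apply: (cvgr_to_le (f_f f)); apply: nearW => n.
  by apply: le_trans (ler_norm _) _; rewrite -[leRHS]mul1r -(f_1 n); exact: rinner_le.
by rewrite rinner_norm; have := L2norm_ge0 f; nra.
Qed.

(** The unit norms freeze the first term at [c], while [symbol] converges pointwise. All vectors
    [pi(z)^* f_n] lie in the unit ball, so a single constant dominates on [Omega]. *)
Lemma LpNorm_weak_cvg (f_ : nat -> L2R) f : (forall n, L2norm (f_ n) = 1) ->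
  (forall g, (fun n => rinner (f_ n) g) @ \oo --> rinner f g) ->
  (fun n => LpNorm Omega p (Q S (f_ n))) @ \oo --> N (fun z => c + symbol f z).
Proof.
move=> f_1 f_f; have f1 := weak_limit_norm_le f_1 f_f.
have [C HC] := quad_bounded S0_positive S0_compact 1.
have E n : LpNorm Omega p (Q S (f_ n)) = N (fun z => c + symbol (f_ n) z).
  apply: LpNorm_real => z; first by rewrite addr_ge0// symbol_ge0.
  by rewrite Q_perturbed f_1 expr1n mulr1.
under eq_fun do rewrite E.
have bd n z : 0 <= c + symbol (f_ n) z <= c + C.
  rewrite addr_ge0 ?symbol_ge0//= lerD2l HC//.
  by rewrite L2norm_adjoint_pi f_1.
have pw z : (fun n => c + symbol (f_ n) z) @ \oo --> c + symbol f z.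
  apply: cvgD; first exact: cvg_cst.
  apply: (quad_weak_cvg S0_positive S0_compact (M := 1)).
  - by move=> n; rewrite L2norm_adjoint_pi f_1.
  - by rewrite L2norm_adjoint_pi.
  (* For fixed [z], testing [pi(z)^* f_n] against [g] is testing [f_n] against [pi_op z g]. *)
  move=> g; rewrite rinner_adjoint_pi rinnerC.
  by under eq_fun do rewrite rinner_adjoint_pi rinnerC; exact: f_f.
have [H _] := @Lnorm_patch_cvg _ _ R (@volume R d) Omega p Omega_measurable Omega_lty p_gt0 _ _ _
  (fun n => measurable_affine_symbol c (f_ n)) (measurable_affine_symbol c f) bd pw.
exact: H.
Qed.

Lemma weakly_cvg_rinner (f_ : nat -> L2R) f g : weakly_cvg f_ f ->
  (fun n => rinner (f_ n) g) @ \oo --> rinner f g.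
Proof.
move=> /(_ g) /cvgrPdist_lt H; apply/cvgrPdist_lt => e e0.
have ec : 0 < (e%:C)%C :> R[i] by rewrite ltcR.
apply: filterS (H _ ec) => n; rewrite /rinner => lt.
rewrite -ltcR; apply: le_lt_trans lt.
rewrite (_ : _ - _ = complex.Re (inner f g - inner (f_ n) g)); first exact: normc_ge_Re.
by case: (inner f g) (inner (f_ n) g) => a b [].
Qed.

Lemma LpNorm_QZ (a : R) f :
  LpNorm Omega p (Q S (a%:C%C *: f)) = ((a ^+ 2)%:E * LpNorm Omega p (Q S f))%E.
Proof.
have pos h z : 0 <= c * L2norm h ^+ 2 + symbol h z.
  by apply: addr_ge0; [apply: mulr_ge0 => //; exact: sqr_ge0|exact: symbol_ge0].
rewrite (LpNorm_real (pos f) (Q_perturbed f)).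
rewrite (LpNorm_real (pos _) (Q_perturbed _)).
have H := @Lnorm_patchZ _ _ R (@volume R d) Omega p Omega_measurable p_gt0 _ _ (sqr_ge0 a)
  (measurable_affine_symbol (c * L2norm f ^+ 2) f) (pos f).
apply: eq_trans H; congr Lnorm; congr patch; apply/funext => z; congr EFin.
rewrite symbolZ L2normZ exprMn real_normK ?num_real//; ring.
Qed.

Lemma LpQ_ratio_unit f : f != 0 ->
  LpQ_ratio Omega p S f = LpNorm Omega p (Q S ((L2norm f)^-1%:C%C *: f)).
Proof.
by move=> f0; rewrite LpNorm_QZ /LpQ_ratio muleC exprVn.
Qed.

Lemma L2norm_normalized f : f != 0 -> L2norm ((L2norm f)^-1%:C%C *: f) = 1.
Proof.
move=> /L2_gt0 f0; rewrite L2normZ ger0_norm ?invr_ge0 ?L2norm_ge0//.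
by rewrite mulVf// gt_eqF.
Qed.

Lemma L2_unit_neq0 f : L2norm f = 1 -> f != 0.
Proof. by apply: contra_eq_neq => ->; rewrite L2norm0 eq_sym oner_eq0. Qed.

(* The weak limit of a maximizing sequence may lose norm; rescaling it to norm one
   (or, if it vanishes, replacing it by any unit vector) does not decrease [c + symbol f]. *)
Lemma unit_dominating f : L2norm f <= 1 -> exists e, L2norm e = 1 /\
  forall z, symbol f z <= symbol e z.
Proof.
move=> f1; have [->|f0] := eqVneq f 0.
  have [e e1] := L2_nontrivial R d; exists e; split=> [|z]; first exact: e1.
  have := symbolZ 0 0 z; rewrite scaler0 expr0n mul0r => ->.
  exact: symbol_ge0.
exists ((L2norm f)^-1%:C%C *: f); split; first exact: L2norm_normalized.
move=> z; rewrite symbolZ ler_peMl ?symbol_ge0// exprn_ege1//.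
by rewrite invf_ge1// L2_gt0.
Qed.

Lemma Lambda_attained : exists f : L2R, f != 0 /\ LpQ_ratio Omega p S f = Lambda Omega p S.
Proof.
have ne : [set LpQ_ratio Omega p S f | f in [set f : L2R | f != 0]] != set0.
  have [e /L2_unit_neq0 e0] := L2_nontrivial R d.
  by apply/set0P; exists (LpQ_ratio Omega p S e); exists e.
have [u uS uL] := ereal_sup_seq ne.
have /choice[g gP] : forall n, exists g : L2R, L2norm g = 1 /\ LpNorm Omega p (Q S g) = u n.
  move=> n; have [f f0 <-] := uS n.
  by eexists; split; [exact: (L2norm_normalized f0)|rewrite -LpQ_ratio_unit].
have g1 n : L2norm (g n) = 1 by exact: (gP n).1.
have [|s [f [sinc gf]]] := @L2_weakly_compact _ _ _ _ g 1; first by move=> n; rewrite g1.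
have f1 := weak_limit_norm_le (fun n => g1 (s n)) gf.
(* Uniqueness of limits in the extended reals covers a supremum not yet known to be finite. *)
have LE : Lambda Omega p S = N (fun z => c + symbol f z).
  have H1 : (fun n => LpNorm Omega p (Q S (g (s n)))) @ \oo --> Lambda Omega p S.
    under eq_fun do rewrite (gP _).2.
    exact: (cvg_comp _ _ (cvg_homo_infty sinc) uL).
  exact: (cvg_unique _ H1 (LpNorm_weak_cvg (fun n => g1 (s n)) gf)).
have [e [e1 fe]] := unit_dominating f1.
have e0 := L2_unit_neq0 e1.
exists e; split => //; apply/eqP; rewrite eq_le; apply/andP; split.
  by apply: ereal_sup_ubound; exists e.
rewrite LE LpQ_ratio_unit// e1 invr1 scale1r.
rewrite (@LpNorm_real _ (fun z => c + symbol e z)).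
- have le z : 0 <= c + symbol f z <= c + symbol e z.
    by apply/andP; split; [rewrite addr_ge0// symbol_ge0|rewrite lerD2l; exact: fe].
  exact: (@le_Lnorm_patch _ _ R (@volume R d) Omega p Omega_measurable p_gt0 _ _
    (measurable_affine_symbol c f) (measurable_affine_symbol c e) le).
- by move=> z; rewrite addr_ge0 ?symbol_ge0.
- by move=> z; rewrite Q_perturbed e1 expr1n mulr1.
Qed.

End maximizer.

Unset Implicit Arguments.

Theorem proposition3p7 (R : realType) (d : nat)
    (S0 : {linear L2Rd R d -> L2Rd R d}) (c : R) (S : L2Rd R d -> L2Rd R d)
    (p : R) (Omega : set (d.-tuple R * d.-tuple R))
    (S0_compact : compact_operator S0) (S0_positive : positive_operator S0)
    (c_ge0 : 0 <= c) (S_def : forall f, S f = (c%:C)%C *: f + S0 f)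
    (p_ge1 : 1 <= p) (Omega_measurable : lebesgue_measurable Omega)
    (Omega_gt0 : (0 < volume Omega)%E) (Omega_lty : (volume Omega < +oo)%E) :
  (forall (f_ : nat -> L2Rd R d) (f : L2Rd R d),
     (forall n, L2norm (f_ n) = 1) -> weakly_cvg f_ f ->
     (LpNorm Omega p (Q S (f_ n)) @[n --> \oo] -->
       LpNorm Omega p (fun z => Q S f z + ((c * (1 - L2norm f ^+ 2))%:C)%C)) /\
     LpNorm Omega p (fun z => Q S f z + ((c * (1 - L2norm f ^+ 2))%:C)%C) =
       LpNorm Omega p (fun z => (c%:C)%C + Q S0 f z)) /\
  (exists f : L2Rd R d, f != 0 /\ LpQ_ratio Omega p S f = Lambda Omega p S).
Proof.
have p_gt0 : 0 < p := lt_le_trans ltr01 p_ge1.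
split; last first.
  exact: (Lambda_attained S0_compact S0_positive c_ge0 S_def p_gt0 Omega_measurable Omega_lty).
move=> f_ f f_1 f_f.
(* The term [c |f|^2] in [Q S f z] and the correction add up to [c], so the two limit functions
   agree at every point. *)
have E z : Q S f z + ((c * (1 - L2norm f ^+ 2))%:C)%C = (c%:C)%C + Q S0 f z.
  rewrite (Q_perturbed S0_positive S_def) (Q_symbol S0_positive) -!rmorphD /=.
  by congr (_%:C)%C; ring.
have -> : (fun z => Q S f z + ((c * (1 - L2norm f ^+ 2))%:C)%C) =
          (fun z => (c%:C)%C + Q S0 f z) by apply/funext.
split => //.
rewrite (@LpNorm_real _ _ _ _ _ (fun z => c + symbol S0 f z)).
- apply: (LpNorm_weak_cvg S0_compact S0_positive c_ge0 S_def p_gt0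
    Omega_measurable Omega_lty f_1) => g.
  exact: weakly_cvg_rinner.
- by move=> z; apply: addr_ge0 => //; exact: symbol_ge0.
- by move=> z; rewrite (Q_symbol S0_positive) -rmorphD.
Qed.
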